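(* Let $\psi:(\mathcal{M},\nabla,g)\to(\mathcal{N},\hat\nabla,\hat g)$ be a statistical submersion. Then $$2R\ \le\ 2\hat R+g(\sigma,\sigma).$$ The equality case holds if and only if $\mathcal{A}_{\mathcal{H}}\mathcal{H}=0$ (that is, $\mathcal{A}_XY=0$ for all horizontal $X,Y$).
   Context: A statistical manifold $(\mathcal{M},\nabla,g)$ is a Riemannian manifold $(\mathcal{M},g)$ with a torsion-free affine connection $\nabla$ such that $(\nabla_Ug)(V,W)=(\nabla_Vg)(U,W)$. A statistical submersion $\psi:(\mathcal{M},\nabla,g)\to(\mathcal{N},\hat\nabla,\hat g)$ between statistical manifolds is a Riemannian submersion with $\psi_{\ast}(\nabla_XY)_r=(\hat\nabla_{\psi_{\ast}X}\psi_{\ast}Y)_{\psi(r)}$ for all basic (i.e. horizontal and projectable) vector fields $X,Y$ and all $r\in\mathcal{M}$. $\mathcal{V},\mathcal{H}$ denote both the vertical and horizontal distributions and the projections onto them. $\mathcal{A}_EF=\mathcal{V}\nabla_{\mathcal{H}E}\mathcal{H}F+\mathcal{H}\nabla_{\mathcal{H}E}\mathcal{V}F$. $\{X_i\}_{1\le i\le n}$ is a local orthonormal basis of the horizontal distribution, and $\sigma=\sum_{i=1}^n\mathcal{A}_{X_i}X_i$. $Rie$ is the curvature tensor of $\nabla$; $\hat{Rie}(X,Y)Z$ is the horizontal vector field with $\psi_{\ast}(\hat{Rie}(X,Y)Z)=\hat{Rie}(\psi_{\ast}X,\psi_{\ast}Y)\psi_{\ast}Z$, where on the right $\hat{Rie}$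 is the curvature tensor of $\hat\nabla$. Put $Rie(X,Y,Z,W)=g(Rie(X,Y)Z,W)$ and similarly for $\hat{Rie}$. In this statement $2R=\sum_{i,j=1}^n Rie(X_i,X_j,X_j,X_i)$ and $2\hat R=\sum_{i,j=1}^n\hat{Rie}(X_i,X_j,X_j,X_i)$. *)

(* Defs.v *)
From HB Require Import structures.
From mathcomp Require Import all_boot all_order all_algebra.
From mathcomp Require Import all_classical all_reals all_analysis.

Set Implicit Arguments.
Unset Strict Implicit.
Unset Printing Implicit Defensive.

Import Order.TTheory GRing.Theory Num.Theory.
Import numFieldNormedType.Exports.

Local Open Scope classical_set_scope.
Local Open Scope ring_scope.

(* f is C^k on O (meant for O open and V finite-dimensional): for k + 1, f is
   differentiable at every point of O and its directional derivatives are C^k. *)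
Fixpoint Ck_on (R : realType) (V W : normedModType R) (k : nat)
    (O : set V) (f : V -> W) : Prop :=
  match k with
  | 0 => forall x, O x -> {for x, continuous f}
  | k'.+1 => (forall x, O x -> differentiable f x) /\
             (forall v : V, Ck_on k' O (fun x => 'd f x v))
  end.

Definition smooth_on (R : realType) (V W : normedModType R)
    (O : set V) (f : V -> W) : Prop := forall k, Ck_on k O f.

(* A smooth m-manifold: a Hausdorff, second countable space with a smooth atlas.
   The atlas is indexed by the points of the space, [chart p] being a chart
   around p with domain [chart_dom p] and inverse [chart_inv p]; any atlas
   contains such a family, and the family determines the smooth structure.
   [chart p] and [chart_inv p] take junk values outside [chart_dom p] and
   [chart p @` chart_dom p] respectively. *)
Record manifold (R : realType) (m : nat) := Manifold {
  point_of :> topologicalType ;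
  chart_dom : point_of -> set point_of ;
  chart : point_of -> point_of -> 'rV[R]_m ;
  chart_inv : point_of -> 'rV[R]_m -> point_of ;
  manifold_hausdorff : hausdorff_space point_of ;
  manifold_second_countable : @second_countable point_of ;
  chart_dom_center : forall p, chart_dom p p ;
  chart_dom_open : forall p, open (chart_dom p) ;
  chart_image_open : forall p, open (chart p @` chart_dom p) ;
  chartK : forall p q, chart_dom p q -> chart_inv p (chart p q) = q ;
  chart_continuous : forall p q, chart_dom p q -> {for q, continuous (chart p)} ;
  chart_inv_continuous : forall p x, (chart p @` chart_dom p) x ->
    {for x, continuous (chart_inv p)} ;
  chart_transition : forall p q,
    smooth_on (chart p @` (chart_dom p `&` chart_dom q)) (chart q \o chart_inv p)
}.

(* f is smooth in a neighbourhood of p. *)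
Definition smooth_at (R : realType) (m : nat) (M : manifold R m)
    (W : normedModType R) (f : M -> W) (p : M) : Prop :=
  exists O : set 'rV[R]_m,
    [/\ open O, O (chart p p) & smooth_on O (f \o chart_inv p)].

(* The tangent space at p is R^m, through the differential of [chart p] at p.
   [mdiff p f v] is df_p(v), for f defined near p with values in a normed
   space; for W = R it is the derivative of f along v. *)
Definition mdiff (R : realType) (m : nat) (M : manifold R m)
    (W : normedModType R) (p : M) (f : M -> W) (v : 'rV[R]_m) : W :=
  'd (f \o chart_inv p) (chart p p) v.

(* A vector field; fields defined only on an open set take junk values
   elsewhere. *)
Definition vfield (R : realType) (m : nat) (M : manifold R m) : Type :=
  M -> 'rV[R]_m.

(* Components of X in the single chart [chart p]. *)
Definition vcoord (R : realType) (m : nat) (M : manifold R m) (p : M)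
    (X : vfield M) : M -> 'rV[R]_m :=
  fun q => mdiff q (chart p) (X q).

Definition vsmooth_at (R : realType) (m : nat) (M : manifold R m)
    (X : vfield M) (p : M) : Prop := smooth_at (vcoord p X) p.

Definition lie_bracket (R : realType) (m : nat) (M : manifold R m)
    (X Y : vfield M) : vfield M :=
  fun p => mdiff p (vcoord p Y) (X p) - mdiff p (vcoord p X) (Y p).

(* Near p, the field with constant components in [chart p] and value u at p. *)
Definition vconst (R : realType) (m : nat) (M : manifold R m) (p : M)
    (u : 'rV[R]_m) : vfield M :=
  fun q => 'd (chart q \o chart_inv p) (chart p q) u.

Record metric (R : realType) (m : nat) (M : manifold R m) := Metric {
  metric_at :> M -> 'rV[R]_m -> 'rV[R]_m -> R ;
  metric_linear : forall p (a : R) u v w,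
    metric_at p (a *: u + v) w = a * metric_at p u w + metric_at p v w ;
  metric_sym : forall p u v, metric_at p u v = metric_at p v u ;
  metric_pos : forall p u, u != 0 -> 0 < metric_at p u u ;
  metric_smooth : forall p X Y, vsmooth_at X p -> vsmooth_at Y p ->
    smooth_at (fun q => metric_at q (X q) (Y q) : R^o) p
}.

(* An affine connection, in the form of its action [nabla p u Y] = (nabla_u Y)_p
   on a tangent vector u at p and a vector field Y smooth near p. Its values at
   fields which are not smooth near p are irrelevant. *)
Record connection (R : realType) (m : nat) (M : manifold R m) := Connection {
  nabla :> forall p : M, 'rV[R]_m -> vfield M -> 'rV[R]_m ;
  nabla_linear : forall p (a : R) u v Y, vsmooth_at Y p ->
    nabla p (a *: u + v) Y = a *: nabla p u Y + nabla p v Y ;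
  nabla_add : forall p u Y Z, vsmooth_at Y p -> vsmooth_at Z p ->
    nabla p u (fun q => Y q + Z q) = nabla p u Y + nabla p u Z ;
  nabla_leibniz : forall p u (f : M -> R^o) Y,
    smooth_at f p -> vsmooth_at Y p ->
    nabla p u (fun q => f q *: Y q) =
      (mdiff p f u : R) *: Y p + (f p : R) *: nabla p u Y ;
  nabla_local : forall p u Y Z, vsmooth_at Y p -> vsmooth_at Z p ->
    (\forall q \near p, Y q = Z q) -> nabla p u Y = nabla p u Z ;
  nabla_smooth : forall p X Y, vsmooth_at X p -> vsmooth_at Y p ->
    vsmooth_at (fun q => nabla q (X q) Y) p
}.

Definition cov (R : realType) (m : nat) (M : manifold R m) (D : connection M)
    (X Y : vfield M) : vfield M := fun p => D p (X p) Y.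

Definition torsion_free (R : realType) (m : nat) (M : manifold R m)
    (D : connection M) : Prop :=
  forall p X Y, vsmooth_at X p -> vsmooth_at Y p ->
    cov D X Y p - cov D Y X p = lie_bracket X Y p.

(* (nabla_U g)(V, W) *)
Definition cov_metric (R : realType) (m : nat) (M : manifold R m)
    (D : connection M) (g : metric M) (U V W : vfield M) (p : M) : R :=
  (mdiff p (fun q => g q (V q) (W q) : R^o) (U p) : R)
  - g p (cov D U V p) (W p) - g p (V p) (cov D U W p).

Definition statistical (R : realType) (m : nat) (M : manifold R m)
    (D : connection M) (g : metric M) : Prop :=
  torsion_free D /\
  forall p U V W, vsmooth_at U p -> vsmooth_at V p -> vsmooth_at W p ->
    cov_metric D g U V W p = cov_metric D g V U W p.

(* Rie(X, Y)Z *)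
Definition curvature (R : realType) (m : nat) (M : manifold R m)
    (D : connection M) (X Y Z : vfield M) : vfield M :=
  fun p => cov D X (cov D Y Z) p - cov D Y (cov D X Z) p
           - cov D (lie_bracket X Y) Z p.

(* The curvature tensor on tangent vectors at p; as it is a tensor, any smooth
   extension of u, v, w to vector fields may be used. *)
Definition curvature_at (R : realType) (m : nat) (M : manifold R m)
    (D : connection M) (p : M) (u v w : 'rV[R]_m) : 'rV[R]_m :=
  curvature D (vconst p u) (vconst p v) (vconst p w) p.

(* The differential of a map between manifolds at p. *)
Definition pushforward (R : realType) (m n : nat) (M : manifold R m)
    (N : manifold R n) (psi : M -> N) (p : M) (v : 'rV[R]_m) : 'rV[R]_n :=
  mdiff p (chart (psi p) \o psi) v.

Definition smooth_map (R : realType) (m n : nat) (M : manifold R m)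
    (N : manifold R n) (psi : M -> N) : Prop :=
  continuous psi /\ forall p, smooth_at (chart (psi p) \o psi) p.

Definition vertical (R : realType) (m n : nat) (M : manifold R m)
    (N : manifold R n) (psi : M -> N) (p : M) (v : 'rV[R]_m) : Prop :=
  pushforward psi p v = 0.

Definition horizontal (R : realType) (m n : nat) (M : manifold R m)
    (N : manifold R n) (g : metric M) (psi : M -> N) (p : M)
    (v : 'rV[R]_m) : Prop :=
  forall w, vertical psi p w -> g p v w = 0.

(* The orthogonal projections of the tangent space at p onto its horizontal
   and vertical subspaces. *)
Definition hproj (R : realType) (m n : nat) (M : manifold R m)
    (N : manifold R n) (g : metric M) (psi : M -> N) (p : M)
    (v : 'rV[R]_m) : 'rV[R]_m :=
  xget 0 [set h | horizontal g psi p h /\ vertical psi p (v - h)].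

Definition vproj (R : realType) (m n : nat) (M : manifold R m)
    (N : manifold R n) (g : metric M) (psi : M -> N) (p : M)
    (v : 'rV[R]_m) : 'rV[R]_m :=
  v - hproj g psi p v.

Definition riemannian_submersion (R : realType) (m n : nat) (M : manifold R m)
    (N : manifold R n) (g : metric M) (gN : metric N) (psi : M -> N) : Prop :=
  [/\ smooth_map psi,
      forall p w, exists v, pushforward psi p v = w &
      forall p u v, horizontal g psi p u -> horizontal g psi p v ->
        gN (psi p) (pushforward psi p u) (pushforward psi p v) = g p u v].

Definition horizontal_on (R : realType) (m n : nat) (M : manifold R m)
    (N : manifold R n) (g : metric M) (psi : M -> N) (U : set M)
    (X : vfield M) : Prop :=
  forall p, U p -> vsmooth_at X p /\ horizontal g psi p (X p).

(* X is a basic vector field on M, projecting to XN on N. *)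
Definition basic (R : realType) (m n : nat) (M : manifold R m)
    (N : manifold R n) (g : metric M) (psi : M -> N)
    (X : vfield M) (XN : vfield N) : Prop :=
  [/\ horizontal_on g psi setT X, forall q, vsmooth_at XN q &
      forall p, pushforward psi p (X p) = XN (psi p)].

Definition statistical_submersion (R : realType) (m n : nat) (M : manifold R m)
    (N : manifold R n) (D : connection M) (g : metric M)
    (DN : connection N) (gN : metric N) (psi : M -> N) : Prop :=
  riemannian_submersion g gN psi /\
  forall X Y XN YN, basic g psi X XN -> basic g psi Y YN ->
    forall r, pushforward psi r (cov D X Y r) = cov DN XN YN (psi r).

(* A_E F *)
Definition tensorA (R : realType) (m n : nat) (M : manifold R m)
    (N : manifold R n) (D : connection M) (g : metric M) (psi : M -> N)
    (E F : vfield M) : vfield M :=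
  let H (X : vfield M) : vfield M := fun p => hproj g psi p (X p) in
  let V (X : vfield M) : vfield M := fun p => vproj g psi p (X p) in
  fun p => V (cov D (H E) (H F)) p + H (cov D (H E) (V F)) p.

(* The horizontal vector at p with image w. *)
Definition hlift (R : realType) (m n : nat) (M : manifold R m)
    (N : manifold R n) (g : metric M) (psi : M -> N) (p : M)
    (w : 'rV[R]_n) : 'rV[R]_m :=
  xget 0 [set h | horizontal g psi p h /\ pushforward psi p h = w].

(* The horizontal lift to M of the curvature tensor of DN. *)
Definition hat_curvature (R : realType) (m n : nat) (M : manifold R m)
    (N : manifold R n) (g : metric M) (DN : connection N) (psi : M -> N)
    (X Y Z : vfield M) : vfield M :=
  fun p => hlift g psi p
    (curvature_at DN (psi p) (pushforward psi p (X p))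
       (pushforward psi p (Y p)) (pushforward psi p (Z p))).

(* A local orthonormal basis of the horizontal distribution on U. The vectors
   span since the horizontal spaces have dimension n = dim N. *)
Definition horizontal_frame (R : realType) (m n : nat) (M : manifold R m)
    (N : manifold R n) (g : metric M) (psi : M -> N) (U : set M)
    (X : 'I_n -> vfield M) : Prop :=
  [/\ open U, forall i, horizontal_on g psi U (X i) &
      forall p, U p -> forall i j, g p (X i p) (X j p) = (i == j)%:R].

Definition sigma_field (R : realType) (m n : nat) (M : manifold R m)
    (N : manifold R n) (D : connection M) (g : metric M) (psi : M -> N)
    (X : 'I_n -> vfield M) : vfield M :=
  fun p => \sum_(i < n) tensorA D g psi (X i) (X i) p.

(* 2R *)
Definition twoR (R : realType) (m n : nat) (M : manifold R m)
    (D : connection M) (g : metric M) (X : 'I_n -> vfield M) (p : M) : R :=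
  \sum_(i < n) \sum_(j < n) g p (curvature D (X i) (X j) (X j) p) (X i p).

(* 2\hat R *)
Definition twoRhat (R : realType) (m n : nat) (M : manifold R m)
    (N : manifold R n) (g : metric M) (DN : connection N) (psi : M -> N)
    (X : 'I_n -> vfield M) (p : M) : R :=
  \sum_(i < n) \sum_(j < n)
    g p (hat_curvature g DN psi (X i) (X j) (X j) p) (X i p).

(* Main.v *)
(* For vertical V and basic X, W, total symmetry of nabla g applied to (V, W, X), together with
   V(g(X, W)) = 0 and the verticality of [V, X], gives g(nabla_X V, W) = g(V, nabla_W X).
   Splitting every nabla_X Y into its horizontal (basic) and vertical part then yields, for
   basic fields,
     Rie(X, Y, Z, W) = hat Rie(X, Y, Z, W) + g(A_Y Z, A_W X) - g(A_X Z, A_W Y)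
                       - g(A_X Y - A_Y X, A_W Z).
   Writing A_ij for A_(X_i) X_j and summing over the frame,
     2R = 2 hat R + g(sigma, sigma) - sum_ij (2 |A_ij|^2 - g(A_ji, A_ij)),
   and the last sum equals sum_ij |A_ij|^2 + 1/2 sum_ij |A_ij - A_ji|^2.

   As curvature and A are tensorial, the frame may be replaced at a point by horizontal lifts
   of vector fields on N which are constant in a chart near the image point and cut off by a
   bump function. *)
Require Import Defs.
From mathcomp Require Import all_boot all_order all_algebra.
From mathcomp Require Import all_classical all_reals all_analysis.
From mathcomp Require Import ring lra.
(* [pushforward] is also a name of the measure theory library. *)
Import Defs.

Import Order.TTheory GRing.Theory Num.Theory.
Import numFieldNormedType.Exports.

Local Open Scope classical_set_scope.
Local Open Scope ring_scope.

Set Implicit Arguments.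
Unset Strict Implicit.

(** * C^k calculus *)

(** The condition on psi speaks only of basic fields on the whole of M, whereas the given frame is
    local and need not be basic. This is why the computation runs on cut-off lifts, smooth
    everywhere, which agree with the frame at a single point. Two features of the definitions shape
    the rest. A connection is an arbitrary function on fields that are not smooth, and fields may
    take junk values off their domain; so a field under nabla is exchanged for another only after
    both are known to be smooth and equal near the point, and for the curvature, which
    differentiates twice, this is needed throughout a neighbourhood. Horizontal lifts and
    projections are picked by choice, so their smooth dependence on the point has to come from an
    explicit formula, here with Gram matrices. The global equality case quantifies over all local
    frames and would say nothing at a point without one; Gram-Schmidt provides a frame near each
    point. *)

Section NearDiff.
Context {R : realType} {V W : normedModType R}.

(** The differential is picked by choice from the first order expansion, so its dependence on the
    germ alone goes through uniqueness. Treating a vanishing germ is enough: two functions that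
    agree near x differ by one. *)
Lemma near0_is_diff (h : V -> W) x : (\forall y \near x, h y = 0) ->
  is_diff x h (0 : V -> W).
Proof.
move=> h0.
have hx : h x = 0 by exact: (nbhs_singleton h0).
have c0 : continuous (\0 : V -> W) by exact: cst_continuous.
have ho : h \o shift x = cst (h x) + (\0 : {linear V -> W}) +o_ 0 id.
  rewrite hx; apply/eqaddoP => e e0; near=> y => /=.
  rewrite !fctE /= !addr0 subr0.
  have -> : h (y + x) = 0.
    near: y; move: h0; rewrite (near_shift 0 x) => h0.
    by near do rewrite -[x in _ + x]subr0 //; exact: h0.
  by rewrite normr0 mulr_ge0 // ltW.
have dE : 'd h x = (\0 : {linear V -> W}) :> (V -> W) by exact: diff_unique.
apply: DiffDef; last by rewrite dE.
by apply/diff_locallyP; rewrite dE; split.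
Unshelve. all: by end_near. Qed.

Lemma near_eq_is_diff (f g : V -> W) x : (\forall y \near x, f y = g y) ->
  differentiable f x -> is_diff x g ('d f x).
Proof.
move=> fg df.
have h0 : \forall y \near x, (g - f) y = 0.
  by apply: filterS fg => y fgy; rewrite !fctE fgy subrr.
have [] := near0_is_diff h0; move: (g - f) (subrK f g) => d <- dd d0.
apply: DiffDef; first exact: differentiableD.
apply: (eq_trans (diffD dd df)); apply/funext => y.
by apply: etrans (add0r _); congr (_ + _); exact: (congr1 (@^~ y) d0).
Qed.

Lemma near_eq_differentiable (f g : V -> W) x :
  (\forall y \near x, f y = g y) -> differentiable f x -> differentiable g x.
Proof. by move=> fg df; have [] := near_eq_is_diff fg df. Qed.

Lemma near_eq_diff (f g : V -> W) x : (\forall y \near x, f y = g y) ->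
  differentiable f x -> 'd g x = 'd f x :> (V -> W).
Proof. by move=> fg df; have [] := near_eq_is_diff fg df. Qed.
End NearDiff.

Lemma differentiable_row {R : realType} {V : normedModType R} n
    (f : V -> 'rV[R]_n) x :
  (forall i, differentiable (fun y => f y 0 i : R^o) x) -> differentiable f x.
Proof.
move=> df.
have -> : f = \sum_(i < n) (fun y => (f y 0 i : R^o) *: delta_mx 0 i : 'rV[R]_n).
  by apply/funext => y; rewrite fct_sumE [LHS]row_sum_delta.
by apply: differentiable_sum => i; exact: differentiableZl.
Qed.

Section DiffRow.
Context {R : realType} {V : normedModType R} {n : nat}.

Lemma differentiable_row_coord (f : V -> 'rV[R]_n) x i :
  differentiable f x -> differentiable (fun y => f y 0 i : R^o) x.
Proof.
move=> df; apply: (@differentiable_comp _ _ _ _ f (fun N : 'rV[R]_n => N 0 i : R^o)) => //.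
exact: differentiable_coord.
Qed.

Lemma diff_row_coord (f : V -> 'rV[R]_n) x i v : differentiable f x ->
  'd (fun y => f y 0 i : R^o) x v = 'd f x v 0 i.
Proof.
move=> df; rewrite -!deriveE //; last exact: differentiable_row_coord.
by rewrite derive_mx ?mxE //; exact: diff_derivable.
Qed.
End DiffRow.

Section Ck.
Context {R : realType} {V : normedModType R}.
Implicit Types (O : set V) (k : nat).

Lemma diff_mul (f g : V -> R^o) x v : differentiable f x -> differentiable g x ->
  'd (fun y => f y * g y : R^o) x v = f x * 'd g x v + g x * 'd f x v.
Proof. by move=> df dg; exact: (congr1 (fun F => F v) (diffM df dg)). Qed.

Lemma diff_add (W : normedModType R) (f g : V -> W) x v :
  differentiable f x -> differentiable g x ->
  'd (fun y => f y + g y) x v = 'd f x v + 'd g x v.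
Proof. by move=> df dg; exact: (congr1 (fun F => F v) (diffD df dg)). Qed.

(** Openness turns equality on O into equality of germs at its points, which is all that
    differentials see. *)
Lemma Ck_on_ext (W : normedModType R) k O (f g : V -> W) : open O ->
  (forall x, O x -> f x = g x) -> Ck_on k O f -> Ck_on k O g.
Proof.
move=> oO; have nO x : O x -> \forall y \near x, O y.
  by move=> Ox; exact: open_nbhs_nbhs.
elim: k f g => [|k IH] f g fg /=.
  move=> fc x Ox; suff : g y @[y --> x] --> g x by []; rewrite -(fg _ Ox).
  apply: cvg_trans (fc x Ox); apply: near_eq_cvg.
  by apply: filterS (nO _ Ox).
have fgx x : O x -> \forall y \near x, f y = g y.
  by move=> Ox; apply: filterS (nO _ Ox).
move=> [df cdf]; split.
  by move=> x Ox; apply: (near_eq_differentiable (fgx _ Ox)); exact: df.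
move=> v; apply: IH (cdf v) => x Ox.
exact/esym/(congr1 (@^~ v) (near_eq_diff (fgx _ Ox) (df _ Ox))).
Qed.

Lemma Ck_on_sub (W : normedModType R) k O O' (f : V -> W) :
  O' `<=` O -> Ck_on k O f -> Ck_on k O' f.
Proof.
move=> OO'; elim: k f => [|k IH] f /=; first by move=> h x /OO'; exact: h.
by move=> [df cdf]; split=> [x /OO'|v]; [exact: df | exact: IH].
Qed.

Lemma Ck_onW (W : normedModType R) k O (f : V -> W) : Ck_on k.+1 O f -> Ck_on k O f.
Proof.
elim: k f => [|k IH] f [df cdf].
  by move=> x Ox; apply: differentiable_continuous; exact: df.
by split=> // v; apply: IH; exact: cdf.
Qed.

Lemma Ck_on_cst (W : normedModType R) k O (c : W) : Ck_on k O (fun=> c).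
Proof.
elim: k c => [|k IH] c /=; first by move=> x _; exact: cst_continuous.
split=> [x _|v]; first exact: differentiable_cst.
by rewrite (_ : (fun _ => _) = fun=> 0) //; apply/funext => x; rewrite diff_cst.
Qed.

Lemma Ck_on_id k O : open O -> Ck_on k O (id : V -> V).
Proof.
move=> oO; case: k => [|k]; first by move=> x _; exact: cvg_id.
split=> [x _|v]; first by have [] := is_diff_id x.
apply: (Ck_on_ext oO _ (Ck_on_cst k O v)) => x _.
by have [_ e] := is_diff_id x; exact: (esym (congr1 (@^~ v) e)).
Qed.

Lemma Ck_on_add (W : normedModType R) k O (f g : V -> W) : open O ->
  Ck_on k O f -> Ck_on k O g -> Ck_on k O (fun x => f x + g x).
Proof.
move=> oO; elim: k f g => [|k IH] f g /=.
  by move=> fc gc x Ox; apply: continuousD; [exact: fc | exact: gc].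
move=> [df cf] [dg cg]; split=> [x Ox|v].
  by apply: (@differentiableD _ _ _ f g); [exact: df | exact: dg].
apply: (Ck_on_ext oO _ (IH _ _ (cf v) (cg v))) => x Ox.
exact/esym/(diff_add v (df _ Ox) (dg _ Ox)).
Qed.

Lemma Ck_on_mul k O (f g : V -> R^o) : open O ->
  Ck_on k O f -> Ck_on k O g -> Ck_on k O (fun x => f x * g x : R^o).
Proof.
move=> oO; elim: k f g => [|k IH] f g.
  by move=> fc gc x Ox; apply: (@continuousM R V f g); [exact: fc | exact: gc].
move=> /[dup] /Ck_onW f0 [df cf] /[dup] /Ck_onW g0 [dg cg]; split=> [x Ox|v].
  by apply: (@differentiableM _ _ f g); [exact: df | exact: dg].
apply: (Ck_on_ext oO _ (Ck_on_add oO (IH _ _ f0 (cg v)) (IH _ _ g0 (cf v)))) => x Ox.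
exact/esym/(diff_mul v (df _ Ox) (dg _ Ox)).
Qed.

Lemma Ck_on_sum (W : normedModType R) k O (I : Type) (s : seq I) (f : I -> V -> W) :
  open O -> (forall i, Ck_on k O (f i)) -> Ck_on k O (fun x => \sum_(i <- s) f i x).
Proof.
move=> oO cf; elim: s => [|i s IH].
  by rewrite (_ : (fun _ => _) = fun=> 0); [exact: Ck_on_cst|apply/funext=> x; rewrite big_nil].
rewrite (_ : (fun _ => _) = fun x => f i x + \sum_(i <- s) f i x).
  exact: Ck_on_add.
by apply/funext=> x; rewrite big_cons.
Qed.

Lemma Ck_on_rowP k O n (f : V -> 'rV[R]_n) : open O ->
  Ck_on k O f <-> forall i, Ck_on k O (fun x => f x 0 i : R^o).
Proof.
move=> oO; split.
  move=> + i; elim: k f => [|k IH] f /=.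
    move=> cf x Ox; apply: (@continuous_comp _ _ _ f (fun N : 'rV[R]_n => N 0 i : R^o)).
      exact: cf.
    exact: coord_continuous.
  move=> [df cf]; split=> [x Ox|v].
    by apply: differentiable_row_coord; exact: df.
  apply: (Ck_on_ext oO _ (IH _ (cf v))) => x Ox.
  exact: esym (diff_row_coord i v (df _ Ox)).
elim: k f => [|k IH] f cf.
  move=> x Ox; have -> : f = \sum_(i < n) (fun y => (f y 0 i : R^o) *: delta_mx 0 i : 'rV[R]_n).
    by apply/funext => y; rewrite fct_sumE [LHS]row_sum_delta.
  elim/big_ind : _ => [|g h gc hc|i _]; first exact: cst_continuous.
    exact: continuousD.
  apply: continuousZr_tmp; exact: (cf i x Ox).
have df x : O x -> differentiable f x.
  by move=> Ox; apply: differentiable_row => i; have [] := cf i; move/(_ x Ox).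
split=> // v; apply: IH => i.
apply: (Ck_on_ext oO _ ((cf i).2 v)) => x Ox.
exact: (diff_row_coord i v (df _ Ox)).
Qed.

End Ck.

Lemma row_diff_basis {R : realType} {W : normedModType R} n (L : {linear 'rV[R]_n -> W}) u :
  L u = \sum_i u 0 i *: L (delta_mx 0 i).
Proof. by rewrite {1}(row_sum_delta u) linear_sum; apply: eq_bigr => i _; rewrite linearZ. Qed.

Section CkComp.
Context {R : realType} {V : normedModType R} {n : nat}.

(** By the chain rule the derivative along v is the sum over i of the i-th coordinate of ['d f x v]
    times the i-th partial derivative of h at f x. The latter is again a scalar function composed
    with f, so the induction on k closes. *)
Lemma Ck_on_comp_scalar k (O : set V) (O' : set 'rV[R]_n) (f : V ->
  'rV[R]_n) (h : 'rV[R]_n -> R^o) :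
  open O -> (forall x, O x -> O' (f x)) -> Ck_on k O f -> Ck_on k O' h -> Ck_on k O (h \o f).
Proof.
move=> oO OO'; elim: k f h OO' => [|k IH] f h OO'.
  move=> cf ch x Ox; apply: continuous_comp; [exact: cf | exact/ch/OO'].
move=> /[dup] /Ck_onW f0 [df cf] [dh ch]; split=> [x Ox|v].
  exact: differentiable_comp (df _ Ox) (dh _ (OO' _ Ox)).
have C i : Ck_on k O (fun x => 'd f x v 0 i * 'd h (f x) (delta_mx 0 i) : R^o).
  apply: Ck_on_mul => //; first by move: (cf v) => /(Ck_on_rowP k _ oO).
  exact: IH (ch _).
apply: (Ck_on_ext oO _ (Ck_on_sum (index_enum 'I_n) oO C)) => x Ox.
rewrite (diff_comp (df _ Ox) (dh _ (OO' _ Ox))).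
exact/esym/row_diff_basis.
Qed.

End CkComp.

Section CkScalar.
Context {R : realType} {V : normedModType R}.

Lemma is_diff_comp_real (phi : R -> R) (d : R) (u : V -> R^o) x :
  is_derive (u x) (1 : R) phi d -> differentiable u x ->
  differentiable (phi \o u : V -> R^o) x /\
  forall v, 'd (phi \o u : V -> R^o) x v = d * 'd u x v.
Proof.
move=> [dphi <-] du.
have dphi' : differentiable (phi : R^o -> R^o) (u x) by apply/derivable1_diffP.
split=> [|v]; first exact: differentiable_comp du dphi'.
rewrite (diff_comp du dphi') /= -[LHS]/('d (phi : R^o -> R^o) (u x) ('d u x v)).
by rewrite (congr1 (@^~ _) (deriv1E dphi)) derive1E mulrC.
Qed.

(** Differentiation maps a member of the family [Phi] to a combination of two members, so the
    induction on k never leaves the family. Real powers and the functions [flat j] are two such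
    families. *)
Lemma Ck_on_comp_real (I : Type) (Phi : I -> R -> R) (c c' : I -> R)
    (s s' : I -> I) (D : set R) (O : set V) (u : V -> R^o) k i :
  (forall i t, D t ->
    is_derive t (1 : R) (Phi i) (c i * Phi (s i) t + c' i * Phi (s' i) t)) ->
  open O -> (forall x, O x -> D (u x)) -> Ck_on k O u ->
  Ck_on k O (Phi i \o u : V -> R^o).
Proof.
move=> dPhi oO OD; elim: k i => [|k IH] i.
  move=> cu x Ox; apply: continuous_comp; first exact: cu.
  by apply/differentiable_continuous/derivable1_diffP; have [] := dPhi i _ (OD _ Ox).
move=> /[dup] /Ck_onW u0 [du cu]; split=> [x Ox|v].
  by have [] := is_diff_comp_real (dPhi i _ (OD _ Ox)) (du _ Ox).
have C j a : Ck_on k O (fun x => a * Phi j (u x) : R^o).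
  by apply: (@Ck_on_mul _ _ _ _ (fun=> a) (Phi j \o u)) => //; [exact: Ck_on_cst|exact: IH].
have := Ck_on_mul oO (Ck_on_add oO (C (s i) (c i)) (C (s' i) (c' i))) (cu v).
apply: Ck_on_ext => // x Ox.
by have [_ ->] := is_diff_comp_real (dPhi i _ (OD _ Ox)) (du _ Ox).
Qed.

Lemma Ck_on_powR k (O : set V) (u : V -> R^o) (a : R) : open O ->
  (forall x, O x -> 0 < u x) -> Ck_on k O u -> Ck_on k O (fun x => u x `^ a : R^o).
Proof.
move=> oO u0; apply: (@Ck_on_comp_real R (fun a t => t `^ a) id (fun=> 0)
  (fun a => a - 1) id [set t | 0 < t]) => // b t t0.
by rewrite mul0r addr0; exact: is_derive1_powR.
Qed.

End CkScalar.

(** * A smooth bump function built from exp(-1/t) *)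

Section Flat.
Context {R : realType}.

(* This family is closed under differentiation up to linear combinations,
   including at t = 0. *)
Definition flat (j : nat) (t : R) : R :=
  if 0 < t then t ^- j * expR (- t^-1) else 0.

Lemma flat_gt0 j t : 0 < t -> 0 < flat j t.
Proof. by move=> t0; rewrite /flat t0 mulr_gt0 ?expR_gt0 // invr_gt0 exprn_gt0. Qed.

Lemma flat_le0 j t : t <= 0 -> flat j t = 0.
Proof. by move=> t0; rewrite /flat ltNge t0. Qed.

Lemma flat_ge0 j t : 0 <= flat j t.
Proof. by have [t0|t0] := ltP 0 t; [exact/ltW/flat_gt0 | rewrite flat_le0]. Qed.

(** The term of degree j + 1 of the exponential series bounds exp(1/t) from below. The factor t that
    is left over makes every [flat j] tend to 0 at 0. *)
Lemma flat_le j (t : R) : `|flat j t| <= j.+1`!%:R * `|t|.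
Proof.
have [t0|t0] := ltP 0 t; last by rewrite flat_le0 // normr0 mulr_ge0.
rewrite ger0_norm ?flat_ge0 // (gtr0_norm t0) /flat t0 expRN ler_pdivrMr ?expR_gt0 //.
have f0 : 0 < j.+1`!%:R :> R by rewrite ltr0n fact_gt0.
have := @expR_ge1Dxn _ t^-1 j; rewrite invr_ge0 (ltW t0) => /(_ isT) h.
have {h}h : t^-1 ^+ j.+1 / j.+1`!%:R <= expR t^-1 by apply: le_trans h; rewrite lerDr.
apply: (@le_trans _ _ (j.+1`!%:R * t * (t^-1 ^+ j.+1 / j.+1`!%:R))).
  have tn0 : t != 0 by rewrite gt_eqF.
  have fn0 : j.+1`!%:R != 0 :> R by rewrite gt_eqF.
  rewrite exprS exprVn; move: (t ^- j) => z.
  by rewrite le_eqVlt; apply/orP; left; apply/eqP; field; rewrite tn0 fn0.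
by rewrite ler_wpM2l // mulr_ge0 // ltW.
Qed.

Lemma is_derive_flat j (t : R) :
  is_derive t (1 : R) (flat j) (- j%:R * flat j.+1 t + 1 * flat j.+2 t).
Proof.
rewrite mul1r; have [t0|t0|t0] := ltgtP 0 t.
- have E : \forall s \near t, s ^- j * expR (- s^-1) = flat j s.
    by near=> s; rewrite /flat ifT //; near: s; exact: lt_nbhsr.
  apply: (near_eq_is_derive E).
  have tn0 : t != 0 by rewrite gt_eqF.
  have d1 : is_derive t (1 : R) (fun s => s^-1) (- t ^- 2).
    have := @is_deriveV R id t 1 1 tn0 (is_derive_id _ _).
    by move=> h; apply: (is_derive_eq h); rewrite scaleNr [_ *: _]mulr1.
  have d2 : is_derive t (1 : R) (fun s => s ^- j) (- j%:R * t ^- j.+1).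
    rewrite (_ : (fun s => _) = (fun s : R => s^-1) ^+ j); last first.
      by apply/funext => s; rewrite -exprVn; elim: (j) => [|i IH]; rewrite ?exprS // IH.
    apply: is_derive_eq; rewrite scalerN mulNr; congr (- _).
    rewrite -[LHS]/(j%:R * t^-1 ^+ j.-1 * t ^- 2).
    case: (j) => [|i]; first by rewrite !mul0r.
    by rewrite /= -mulrA exprVn -invfM -exprD addn2.
  have d3 : is_derive t (1 : R) (fun s => expR (- s^-1)) (expR (- t^-1) * t ^- 2).
    have d4 : is_derive t (1 : R) (fun s => - s^-1) (t ^- 2).
      by have := @is_deriveN _ _ _ _ t 1 _ d1; rewrite opprK.
    exact: (@is_derive1_comp _ expR (fun s => - s^-1) t _ _ (is_derive_expR _) d4).
  apply: is_derive_eq.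
  rewrite /flat t0 -[LHS]/(t ^- j * (expR (- t^-1) / t ^+ 2) +
    expR (- t^-1) * (- j%:R / t ^+ j.+1)) !exprS expr0.
  have := expf_neq0 j tn0; move: (t ^+ j) (expR _) => z y zn0.
  by field; rewrite tn0 zn0.
- have E : \forall s \near t, 0 = flat j s.
    by near=> s; rewrite flat_le0 // ltW //; near: s; exact: lt_nbhsl.
  apply: (near_eq_is_derive E); rewrite !flat_le0 ?ltW // mulr0 addr0.
  exact: is_derive_cst.
- rewrite -t0 !flat_le0 // mulr0 addr0.
  have H : (h^-1 *: (flat j (h *: 1 + 0) - flat j 0)) @[h --> 0^'] --> (0 : R).
    apply/cvgrPdist_le => e e0; near=> h.
    have hn0 : h != 0 by near: h; exact: nbhs_dnbhs_neq.
    rewrite addr0 [_ *: 1]mulr1 (flat_le0 j (lexx 0)) subr0 sub0r normrN.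
    (* Dividing by h only raises the index, so the difference quotient at 0 is controlled by
       [flat_le] for j + 1. *)
    have -> : h^-1 *: flat j h = flat j.+1 h.
      by rewrite /flat; case: ifP => _; rewrite ?scaler0 // exprS invfM [_ *: _]mulrA.
    apply: le_trans (flat_le _ _) _.
    rewrite -ler_pdivlMl ?ltr0n ?fact_gt0 //; near: h.
    by apply: dnbhs0_le; rewrite mulr_gt0 // invr_gt0 ltr0n fact_gt0.
  split; first by apply/cvg_ex; exists 0; exact: H.
  exact: cvg_lim H.
Unshelve. all: by end_near. Qed.

Lemma Ck_on_flat (V : normedModType R) k (O : set V) (u : V -> R^o) : open O ->
  Ck_on k O u -> Ck_on k O (fun x => flat 0 (u x) : R^o).
Proof.
move=> oO; apply: (@Ck_on_comp_real R V nat flat (fun j => - j%:R) (fun=> 1)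
  succn (fun j => j.+2) setT) => // j t _; exact: is_derive_flat.
Qed.

(** The quotient flat(u) / (flat(u) + flat(1 - u)), with [flat 0] for flat, is 1 where u >= 1 and 0
    where u <= 0. Here u = 2 - a q with q the squared Euclidean distance to c, which is a
    polynomial, whereas the norm on row vectors is the maximum norm. The division is written as a
    real power with exponent -1. *)
Lemma bump_function n (c : 'rV[R]_n) (O : set 'rV[R]_n) : open O -> O c ->
  exists b : 'rV[R]_n -> R^o, exists K : set 'rV[R]_n,
  [/\ smooth_on setT b, \forall x \near c, b x = 1,
      compact K, K `<=` O & forall x, ~ K x -> b x = 0].
Proof.
move=> oO Oc.
have /nbhs_ballP[e /= e0 eO] : nbhs c O by exact: open_nbhs_nbhs.
pose q (x : 'rV[R]_n) : R^o := \sum_(i < n) (x 0 i - c 0 i) * (x 0 i - c 0 i).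
(* With this a, u >= 0 gives q <= e^2 / 4 < e^2, so the set where u >= 0 lies in the ball of radius
   e. *)
pose a : R := 8 / e ^+ 2.
have a0 : 0 < a by rewrite divr_gt0 // exprn_gt0.
pose u x : R^o := 2 + - a * q x.
have oT : open [set: 'rV[R]_n] by exact: openT.
have cqi k i : Ck_on k setT (fun x : 'rV[R]_n => x 0 i - c 0 i : R^o).
  apply: (Ck_on_add oT _ (Ck_on_cst _ _ _)).
  exact: ((Ck_on_rowP k _ oT).1 (Ck_on_id k oT)).
have cq k : Ck_on k setT q.
  by apply: Ck_on_sum => // i; exact: Ck_on_mul.
have cu k : Ck_on k setT u.
  by apply: Ck_on_add => //; [exact: Ck_on_cst|apply: Ck_on_mul => //; exact: Ck_on_cst].
pose w x : R^o := 1 + - 1 * u x.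
have cw k : Ck_on k setT w.
  by apply: Ck_on_add => //; [exact: Ck_on_cst|apply: Ck_on_mul => //; exact: Ck_on_cst].
pose den x : R^o := flat 0 (u x) + flat 0 (w x).
have den0 x : 0 < den x.
  have [u0|u0] := ltP 0 (u x); first by rewrite ltr_pwDl ?flat_gt0 ?flat_ge0.
  rewrite ltr_wpDl ?flat_ge0 // flat_gt0 // /w mulN1r subr_gt0.
  by rewrite (le_lt_trans u0).
exists (fun x => flat 0 (u x) * den x `^ (-1)); exists [set x | 0 <= u x].
have uc : u c = 2.
  by rewrite /u /q big1 ?mulr0 ?addr0 // => i _; rewrite subrr mul0r.
have contu : continuous u by move=> x; exact: (cu 0%N x).
have KO x : 0 <= u x -> forall i, `|x 0 i - c 0 i| < e.
  move=> ux i.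
  have q1 : (x 0 i - c 0 i) ^+ 2 <= q x.
    rewrite /q (bigD1 i) //= expr2 lerDl; apply: sumr_ge0 => j _.
    by rewrite -expr2 sqr_ge0.
  have q2 : a * q x <= 2 by move: ux; rewrite /u; lra.
  have q3 : q x < e ^+ 2.
    move: q2; rewrite /a mulrAC ler_pdivrMr ?exprn_gt0 // => q2.
    have : 0 < e ^+ 2 by rewrite exprn_gt0.
    by lra.
  rewrite -(@ltr_pXn2r _ 2) ?nnegrE ?normr_ge0 ?(ltW e0) //.
  by rewrite real_normK ?num_real // (le_lt_trans q1).
split.
- move=> k; apply: Ck_on_mul => //; first exact: Ck_on_flat.
  apply: Ck_on_powR => //; apply: Ck_on_add => //; exact: Ck_on_flat.
- have : \forall x \near c, 1 < u x.
    have := contu c; rewrite /continuous_at uc => /cvgr_gt; apply; lra.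
  apply: filterS => x ux; have w0 : w x <= 0 by rewrite /w; lra.
  rewrite powR_inv1 ?(ltW (den0 x)) // /den [flat 0 (w x)]flat_le0 // addr0 divff //.
  by rewrite gt_eqF // flat_gt0 // (lt_trans _ ux).
- apply: (@bounded_closed_compact R n).
    exists (`|c| + e); split; first by rewrite num_real.
    move=> M cM x /= ux; rewrite /Num.Def.normr /= mx_normrE.
    apply: bigmax_le; first by rewrite (le_trans _ (ltW cM)) // addr_ge0 // ltW.
    move=> [i j] _ /=; rewrite (ord1 i); apply: le_trans (ltW cM).
    rewrite -(subrK (c 0 j) (x 0 j)) (le_trans (ler_normD _ _)) // addrC lerD //.
      rewrite /Num.Def.normr /= mx_normrE; apply/bigmax_geP; right => /=; by exists (0, j).
    exact/ltW/KO.
  rewrite (_ : [set x | 0 <= u x] = u @^-1` [set t | 0 <= t]) //.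
  apply: closed_comp => // x _; exact: contu.
- move=> x ux; apply: eO; rewrite -ball_normE /=.
  rewrite /Num.Def.normr /= mx_normrE; apply: bigmax_lt => // -[i j] _ /=.
  by rewrite (ord1 i) !mxE distrC KO.
- by move=> x /negP; rewrite -ltNge => ux; rewrite flat_le0 ?mul0r ?ltW.
Qed.
End Flat.

(** * Symmetry of second derivatives *)

Section Schwarz.
Context {R : realType} {V : normedModType R}.

Lemma is_derive_line (G : V -> R^o) (y u : V) (s : R) :
  differentiable G (y + s *: u) ->
  is_derive s (1 : R) (fun s => G (y + s *: u)) ('d G (y + s *: u) u).
Proof.
move=> dG; pose l (s : R^o) : V := y + s *: u.
have [dl el] : is_diff (s : R^o) l ( *:%R^~ u : R^o -> V).
  have [d e] := is_diffD (is_diff_cst y (s : R^o)) (is_diff_scalel (s : R^o) u).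
  by apply: DiffDef; [exact: d | rewrite [LHS]e; apply/funext => h; exact: add0r].
have dGl : differentiable (G \o l) (s : R^o) by exact: differentiable_comp.
split; first exact: diff_derivable.
apply: etrans (deriveE _ dGl) _; rewrite (diff_comp dl dG) /= el.
by rewrite scale1r.
Qed.

(* The mean value theorem, first in the direction u and then in the direction v. *)
Lemma second_difference (F : V -> R^o) (O : set V) (x u v : V) (e : R) :
  open O -> O x -> Ck_on 2 O F -> 0 < e ->
  \forall t \near 0^'+, exists2 c : R,
    F (x + t *: v + t *: u) - F (x + t *: u) - (F (x + t *: v) - F x) = c * t * t &
    `|c - 'd (fun y => 'd F y u) x v| <= e.
Proof.
move=> oO Ox [dF cF] e0; pose Fu y : R^o := 'd F y u.
have [dFu cFu] := cF u; have cFuv := cFu v.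
have : \forall y \near x, O y /\ `|'d Fu y v - 'd Fu x v| <= e.
  near=> y; split; first by near: y; exact: open_nbhs_nbhs.
  near: y; move/cvgrPdist_le : (cFuv x Ox) => /(_ e e0).
  by apply: filterS => y; rewrite distrC.
move=> /nbhs_ballP[r /= r0 rO].
near=> t.
have t0 : 0 < t by near: t; exact: nbhs_right_gt.
have tuv : t * (`|u| + `|v|) < r.
  have D : 0 < `|u| + `|v| + 1 by rewrite ltr_wpDl // addr_ge0.
  apply: (@le_lt_trans _ _ (t * (`|u| + `|v| + 1))); first by rewrite ler_pM2l // lerDl.
  by rewrite -ltr_pdivlMr //; near: t; apply: nbhs_right_lt; rewrite divr_gt0.
have B s s' : 0 <= s <= t -> 0 <= s' <= t ->
    O (x + s' *: v + s *: u) /\ `|'d Fu (x + s' *: v + s *: u) v - 'd Fu x v| <= e.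
  move=> /andP[s0 st] /andP[s'0 s't]; apply: rO; rewrite -ball_normE /=.
  rewrite -addrA opprD addrA subrr add0r normrN.
  apply: le_lt_trans (ler_normD _ _) _; rewrite !normrZ !ger0_norm // addrC.
  by apply: le_lt_trans tuv; rewrite mulrDr lerD // ler_wpM2r.
have z0t : 0 <= (0 : R) <= t by apply/andP; split=> //; exact: ltW.
have ztt : 0 <= t <= t by apply/andP; split=> //; exact: ltW.
pose phi s : R := F (x + t *: v + s *: u) - F (x + 0 *: v + s *: u).
have dphi s : s \in `[0, t] -> is_derive s (1 : R) phi
    (Fu (x + t *: v + s *: u) - Fu (x + 0 *: v + s *: u)).
  rewrite in_itv => sI; apply: is_deriveB.
    by apply: is_derive_line; apply: dF; have [] := B s t sI ztt.
  by apply: is_derive_line; apply: dF; have [] := B s 0 sI z0t.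
have sub s : s \in `]0, t[ -> s \in `[0, t].
  by rewrite !in_itv /= => /andP[/ltW a /ltW b]; apply/andP.
have [|xi xi0 phiE] := MVT t0 (fun s sI => dphi s (sub s sI)).
  by apply: derivable_within_continuous => s /dphi [].
have xiI : 0 <= xi <= t by have := sub _ xi0; rewrite in_itv.
pose ga s : R := Fu (x + xi *: u + s *: v).
have dga s : s \in `[0, t] -> is_derive s (1 : R) ga ('d Fu (x + xi *: u + s *: v) v).
  rewrite in_itv => sI; apply: is_derive_line; apply: dFu.
  by have [] := B xi s xiI sI; rewrite addrAC.
have [|eta eta0 gaE] := MVT t0 (fun s sI => dga s (sub s sI)).
  by apply: derivable_within_continuous => s /dga [].
have etaI : 0 <= eta <= t by have := sub _ eta0; rewrite in_itv.
exists ('d Fu (x + xi *: u + eta *: v) v); last first.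
  by have [_] := B xi eta xiI etaI; rewrite addrAC.
move: phiE gaE; rewrite /phi /ga !subr0 !scale0r !addr0 => phiE gaE.
by rewrite -gaE (addrAC x (xi *: u)) -phiE.
Unshelve. all: by end_near. Qed.

(** The second difference is symmetric in u and v. Hence, for small t, one and the same number c
    lies within e / 2 of both mixed derivatives. *)
Lemma diff_diff_sym (F : V -> R^o) (O : set V) (x u v : V) :
  open O -> O x -> Ck_on 2 O F ->
  'd (fun y => 'd F y u : R^o) x v = 'd (fun y => 'd F y v : R^o) x u.
Proof.
move=> oO Ox cF; apply/eqP; rewrite -subr_eq0 -normr_le0.
apply/ler_addgt0Pr => e e0; rewrite add0r; have e20 : 0 < e / 2 by rewrite divr_gt0.
have : \forall t \near (0 : R)^'+, `|'d (fun y => 'd F y u :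
  R^o) x v - 'd (fun y => 'd F y v : R^o) x u| <= e.
  have H1 := second_difference u v oO Ox cF e20.
  have H2 := second_difference v u oO Ox cF e20.
  near=> t.
  have t0 : 0 < t by near: t; exact: nbhs_right_gt.
  have [|c1 E1 L1] := near H1 t; first by [].
  have [|c2 E2 L2] := near H2 t; first by [].
  have E : c1 = c2.
    have tn0 : t != 0 by rewrite gt_eqF.
    apply/(mulIf tn0)/(mulIf tn0); rewrite -E1 -E2 (addrAC x).
    by ring.
  rewrite (splitr e); apply: le_trans (lerD L1 L2).
  by rewrite E -[X in `|X|](subrKA c2) (le_trans (ler_normD _ _)) // distrC.
by move=> /filter_ex[].
Unshelve. all: by end_near. Qed.
End Schwarz.

(** * Functions and vector fields on manifolds *)

Section ManifoldCalculus.
Context {R : realType} {m : nat} {M : manifold R m}.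
Implicit Types (p q : M) (f g : M -> R^o) (X Y : vfield M) (O : set 'rV[R]_m).

Lemma chart_dom_near p q : chart_dom p q -> \forall q' \near q, chart_dom p q'.
Proof. by move=> pq; apply: open_nbhs_nbhs; split=> //; exact: chart_dom_open. Qed.

(** By definition only the image of the whole chart domain is open; continuity of [chart_inv] cuts
    it down to A. *)
Lemma chart_image_open_sub p (A : set M) : open A ->
  open (chart p @` (chart_dom p `&` A)).
Proof.
move=> oA; rewrite openE => _ [q [pq Aq] <-]; rewrite /interior.
have im : (chart p @` chart_dom p) (chart p q) by exists q.
have n1 : \forall x \near chart p q, (chart p @` chart_dom p) x.
  by apply: open_nbhs_nbhs; split=> //; exact: chart_image_open.
have n2 : \forall x \near chart p q, A (chart_inv p x).
  apply: (@chart_inv_continuous _ _ M p _ im); rewrite chartK //.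
  exact: open_nbhs_nbhs.
near=> x; have [q' pq1 xE] : (chart p @` chart_dom p) x by near: x.
exists q' => //; split=> //; rewrite -(chartK pq1) xE; near: x; exact: n2.
Unshelve. all: by end_near. Qed.

Lemma near_chart_inv p q (P : set M) : chart_dom p q -> (\forall q' \near q, P q') ->
  \forall x \near chart p q, P (chart_inv p x).
Proof.
move=> pq Pq; apply: (@chart_inv_continuous _ _ M p (chart p q)); first by exists q.
by rewrite chartK.
Qed.

Lemma chart_invK p x : (chart p @` chart_dom p) x -> chart p (chart_inv p x) = x.
Proof. by move=> [q pq <-]; rewrite chartK. Qed.

Lemma near_chart_invK p q : chart_dom p q ->
  \forall x \near chart p q, chart p (chart_inv p x) = x.
Proof.
move=> pq; have : \forall x \near chart p q, (chart p @` chart_dom p) x.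
  by apply: open_nbhs_nbhs; split; [exact: chart_image_open | exists q].
by apply: filterS => x; exact: chart_invK.
Qed.

(** [smooth_at] uses the chart attached to the point itself, which changes with the point. Arguments
    on a neighbourhood need one fixed chart p while q varies. *)
Definition smooth_in_chart (p : M) (f : M -> R^o) (q : M) : Prop :=
  exists O : set 'rV[R]_m, [/\ open O, O (chart p q) & smooth_on O (f \o chart_inv p)].

Lemma smooth_in_chart_change p p1 f q : chart_dom p q -> chart_dom p1 q ->
  smooth_in_chart p f q -> smooth_in_chart p1 f q.
Proof.
move=> pq p1q [ O [oO Oq sf]].
pose A := chart_dom p `&` (interior (chart p @^-1` O)).
have oA : open A by apply: openI; [exact: chart_dom_open | exact: open_interior].
have Aq : A q.
  split=> //; apply: (chart_continuous pq).
  exact: open_nbhs_nbhs.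
pose T := chart p1 @` (chart_dom p1 `&` A).
have oT : open T by exact: chart_image_open_sub.
exists T; split=> //; first by exists q.
move=> k; pose tau := chart p \o chart_inv p1.
have tT x : T x -> O (tau x).
  by move=> [q' [p1q1 [_ /interior_subset Oq1]] <-]; rewrite /tau /= chartK.
have ctau : Ck_on k T tau.
  apply: Ck_on_sub (chart_transition p1 p k).
  by move=> _ [q' [p1q1 [pq1 _]] <-]; exists q'.
apply: (Ck_on_ext oT _ (Ck_on_comp_scalar oT tT ctau (sf k))) => _ [q' [p1q1 [pq1 _]] <-].
by rewrite /tau /= (chartK p1q1) (chartK pq1).
Qed.

Lemma smooth_at_chartP p q f : chart_dom p q ->
  smooth_at f q <-> smooth_in_chart p f q.
Proof.
by move=> pq; split; apply: smooth_in_chart_change => //; exact: chart_dom_center.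
Qed.

Lemma smooth_at_near p f : smooth_at f p -> \forall q \near p, smooth_at f q.
Proof.
move=> [ O [oO Op sf]]; have pp := chart_dom_center p.
have n1 : \forall q \near p, O (chart p q).
  by apply: (chart_continuous pp); exact: open_nbhs_nbhs.
apply: filterS2 (chart_dom_near pp) n1 => q pq Oq.
by apply/(smooth_at_chartP _ pq); exists O.
Qed.

Lemma smooth_at_ext p f g : (\forall q \near p, f q = g q) -> smooth_at f p -> smooth_at g p.
Proof.
move=> fg [ O [oO Op sf]]; have pp := chart_dom_center p.
pose T := O `&` chart p @` (chart_dom p `&` interior [set q | f q = g q]).
have oT : open T by apply: openI => //; apply/chart_image_open_sub/open_interior.
exists T; split=> //; first by split=> //; exists p.
move=> k; apply: (Ck_on_ext oT _ (Ck_on_sub _ (sf k))); last by move=> x [].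
by move=> _ [_ [q [pq /interior_subset fgq] <-]]; rewrite /= chartK.
Qed.

Lemma smooth_at_binop (op : (M -> R^o) -> (M -> R^o) -> M -> R^o) p f g :
  (forall k O, open O -> Ck_on k O (f \o chart_inv p) -> Ck_on k O (g \o chart_inv p) ->
     Ck_on k O (op f g \o chart_inv p)) ->
  smooth_at f p -> smooth_at g p -> smooth_at (op f g) p.
Proof.
move=> H [ O [oO Op sf]] [ O' [oO' Op' sg]]; have oI := openI oO oO'.
exists (O `&` O'); split=> // k; apply: H => //.
  by apply: Ck_on_sub (sf k) => x [].
by apply: Ck_on_sub (sg k) => x [].
Qed.

Lemma smooth_at_cst p (c : R^o) : smooth_at (fun=> c : R^o) p.
Proof. by exists setT; split; [exact: openT| |move=> k; exact: (Ck_on_cst k setT c)]. Qed.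

Lemma smooth_at_add p f g : smooth_at f p -> smooth_at g p ->
  smooth_at (fun q => f q + g q : R^o) p.
Proof. by apply: (@smooth_at_binop (fun f g q => f q + g q)) => k O oO; exact: Ck_on_add. Qed.

Lemma smooth_at_mul p f g : smooth_at f p -> smooth_at g p ->
  smooth_at (fun q => f q * g q : R^o) p.
Proof. by apply: (@smooth_at_binop (fun f g q => f q * g q)) => k O oO; exact: Ck_on_mul. Qed.

Lemma smooth_at_sum p (I : Type) (s : seq I) (f : I -> M -> R^o) :
  (forall i, smooth_at (f i) p) -> smooth_at (fun q => \sum_(i <- s) f i q : R^o) p.
Proof.
move=> sf; elim: s => [|i s IH].
  by apply: smooth_at_ext (smooth_at_cst p 0); near=> q; rewrite big_nil.
by apply: smooth_at_ext (smooth_at_add (sf i) IH); near=> q; rewrite big_cons.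
Unshelve. all: by end_near. Qed.

Lemma smooth_at_prod p (I : Type) (s : seq I) (f : I -> M -> R^o) :
  (forall i, smooth_at (f i) p) -> smooth_at (fun q => \prod_(i <- s) f i q : R^o) p.
Proof.
move=> sf; elim: s => [|i s IH].
  by apply: smooth_at_ext (smooth_at_cst p 1); near=> q; rewrite big_nil.
by apply: smooth_at_ext (smooth_at_mul (sf i) IH); near=> q; rewrite big_cons.
Unshelve. all: by end_near. Qed.

Lemma smooth_at_continuous p f : smooth_at f p -> {for p, continuous f}.
Proof.
move=> [ O [oO Op sf]]; have pp := chart_dom_center p.
have c0 : {for p, continuous ((f \o chart_inv p) \o chart p)}.
  apply: continuous_comp; first exact: chart_continuous.
  exact: (sf 0%N).
have E : \forall q \near p, ((f \o chart_inv p) \o chart p) q = f q.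
  by apply: filterS (chart_dom_near pp) => q pq; rewrite /= chartK.
have : f q @[q --> p] --> f p; last by [].
rewrite -[in X in _ --> X](nbhs_singleton E).
by apply: cvg_trans c0; apply: near_eq_cvg.
Qed.

Lemma smooth_at_powR p f (a : R) : 0 < f p -> smooth_at f p ->
  smooth_at (fun q => f q `^ a : R^o) p.
Proof.
move=> f0 /[dup] /smooth_at_continuous cf [ O [oO Op sf]]; have pp := chart_dom_center p.
have fn : \forall q \near p, 0 < f q by exact: (cvgr_gt (f p) cf).
pose T := O `&` chart p @` (chart_dom p `&` interior [set q | 0 < f q]).
have oT : open T by apply: openI => //; apply/chart_image_open_sub/open_interior.
exists T; split=> //; first by split=> //; exists p.
move=> k; apply: (@Ck_on_powR _ _ k T (f \o chart_inv p) a oT) => [x|].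
  by move=> [_ [q [pq /interior_subset fgq] <-]]; rewrite /= chartK.
by apply: Ck_on_sub (sf k) => x [].
Qed.

Lemma smooth_in_chart_comp p q (G : 'rV[R]_m -> R^o) O : chart_dom p q -> open O ->
  O (chart p q) -> smooth_on O G -> smooth_at (G \o chart p) q.
Proof.
move=> pq oO Oq sG; apply/(smooth_at_chartP _ pq).
pose T := O `&` chart p @` chart_dom p.
have oT : open T by apply: openI => //; exact: chart_image_open.
exists T; split; [exact: oT | by split=> //; exists q | ].
move=> k; apply: (Ck_on_ext oT _ (Ck_on_sub _ (sG k))); last by move=> x [].
by move=> x [_ im]; rewrite /= chart_invK.
Qed.

Lemma chart_coord_smooth p q i : chart_dom p q ->
  smooth_at (fun q => chart p q 0 i : R^o) q.
Proof.
move=> pq; have oT : open [set: 'rV[R]_m] by exact: openT.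
apply: (@smooth_in_chart_comp p q (fun x => x 0 i) setT) => // k.
exact: ((Ck_on_rowP k _ oT).1 (Ck_on_id k oT)).
Qed.

Lemma smooth_in_chart_diff p q f : chart_dom p q -> smooth_at f q ->
  differentiable (f \o chart_inv p) (chart p q).
Proof. by move=> pq /(smooth_at_chartP _ pq) [ O [oO Oq sf]]; exact: ((sf 1%N).1 _ Oq). Qed.

Lemma smooth_at_diff p f : smooth_at f p -> differentiable (f \o chart_inv p) (chart p p).
Proof. exact/smooth_in_chart_diff/chart_dom_center. Qed.

Lemma mdiff_ext (W : normedModType R) p (f g : M -> W) v : (\forall q \near p, f q = g q) ->
  differentiable (f \o chart_inv p) (chart p p) -> mdiff p g v = mdiff p f v.
Proof.
move=> fg df; apply: (congr1 (@^~ v) (near_eq_diff _ df)).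
exact: (near_chart_inv (chart_dom_center p) fg).
Qed.

Lemma transition_diff p q : chart_dom p q ->
  differentiable (chart p \o chart_inv q) (chart q q).
Proof.
move=> pq; apply: (chart_transition q p 1%N).1.
by exists q => //; split=> //; exact: chart_dom_center.
Qed.

(** Chain rule for the transition map: a tangent vector at q is given by its components in
    [chart q], and [mdiff q (chart p)] converts them to components in [chart p]. *)
Lemma mdiff_change (W : normedModType R) p q (f : M -> W) v : chart_dom p q ->
  differentiable (f \o chart_inv p) (chart p q) ->
  differentiable (f \o chart_inv q) (chart q q) /\
  mdiff q f v = 'd (f \o chart_inv p) (chart p q) (mdiff q (chart p) v).
Proof.
move=> pq df; have qq := chart_dom_center q.
have E : \forall x \near chart q q,
    ((f \o chart_inv p) \o (chart p \o chart_inv q)) x = (f \o chart_inv q) x.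
  apply: (near_chart_inv qq (P := fun q => f (chart_inv p (chart p q)) = f q)).
  by apply: filterS (chart_dom_near pq) => q' /chartK ->.
have dt := transition_diff pq.
have xE : (chart p \o chart_inv q) (chart q q) = chart p q by rewrite /= chartK.
have df' : differentiable (f \o chart_inv p) ((chart p \o chart_inv q) (chart q q)).
  by rewrite xE.
have dc := differentiable_comp dt df'.
split; first exact: near_eq_differentiable E dc.
apply: etrans (congr1 (@^~ v) (near_eq_diff E dc)) _.
apply: etrans (congr1 (@^~ v) (diff_comp dt df')) _.
exact: (congr1 (fun x => 'd (f \o chart_inv p) x (mdiff q (chart p) v)) xE).
Qed.

End ManifoldCalculus.

(** * Smooth vector fields and the Lie bracket *)

Section VectorFields.
Context {R : realType} {m : nat} {M : manifold R m}.
Implicit Types (p q : M) (f g : M -> R^o) (X Y : vfield M) (O : set 'rV[R]_m).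

Lemma mdiffD (W : normedModType R) p (f : M ->
  W) u v : mdiff p f (u + v) = mdiff p f u + mdiff p f v.
Proof. exact: linearD. Qed.

Lemma mdiffZ (W : normedModType R) p (f : M -> W) a v : mdiff p f (a *: v) = a *: mdiff p f v.
Proof. exact: linearZ. Qed.

Lemma mdiffB (W : normedModType R) p (f : M ->
  W) u v : mdiff p f (u - v) = mdiff p f u - mdiff p f v.
Proof. exact: linearB. Qed.

Lemma mdiff0 (W : normedModType R) p (f : M -> W) : mdiff p f 0 = 0.
Proof. exact: linear0. Qed.

Lemma mdiff_sum (W : normedModType R) p (f : M -> W) (I : Type) (s : seq I) (v : I -> 'rV[R]_m) :
  mdiff p f (\sum_(i <- s) v i) = \sum_(i <- s) mdiff p f (v i).
Proof. exact: linear_sum. Qed.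

Lemma mdiff_cst p (c : R^o) v : mdiff p (fun=> c) v = 0.
Proof. exact: (congr1 (@^~ v) (diff_cst _ _)). Qed.

Lemma mdiff_mul p f g v : smooth_at f p -> smooth_at g p ->
  mdiff p (fun q => f q * g q : R^o) v = f p * mdiff p g v + g p * mdiff p f v.
Proof.
move=> /smooth_at_diff df /smooth_at_diff dg.
have := diff_mul v df dg; rewrite /= !chartK //; exact: chart_dom_center.
Qed.

Lemma mdiff_add p f g v : smooth_at f p -> smooth_at g p ->
  mdiff p (fun q => f q + g q : R^o) v = mdiff p f v + mdiff p g v.
Proof. by move=> /smooth_at_diff df /smooth_at_diff dg; exact: (diff_add v df dg). Qed.

Lemma mdiff_fsum p (I : Type) (s : seq I) (f : I -> M -> R^o) v :
  (forall i, smooth_at (f i) p) ->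
  mdiff p (fun q => \sum_(i <- s) f i q : R^o) v = \sum_(i <- s) mdiff p (f i) v.
Proof.
move=> sf; elim: s => [|i s IH].
  rewrite (_ : (fun _ => _) = fun=> 0) ?mdiff_cst ?big_nil //.
  by apply/funext => q; rewrite big_nil.
have -> : (fun q => \sum_(j <- i :: s) f j q : R^o) = fun q => f i q + \sum_(j <- s) f j q.
  by apply/funext => q; rewrite big_cons.
apply: etrans (mdiff_add v (sf i) (smooth_at_sum s sf)) _.
by rewrite big_cons IH.
Qed.

Lemma smooth_mdiff_ext p f g v : (\forall q \near p, f q = g q) -> smooth_at f p ->
  mdiff p g v = mdiff p f v.
Proof. by move=> fg /smooth_at_diff; exact: mdiff_ext. Qed.

Lemma mdiff_chart_self p v : mdiff p (chart p) v = v.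
Proof.
have [d e] := is_diff_id (chart p p).
have E : \forall x \near chart p p, id x = (chart p \o chart_inv p) x.
  by apply: filterS (near_chart_invK (chart_dom_center p)) => x /= ->.
apply: etrans (congr1 (@^~ v) (near_eq_diff E d)) _.
exact: (congr1 (@^~ v) e).
Qed.

Definition chart_coord p i : M -> R^o := fun q => chart p q 0 i.

Lemma mdiff_chart_coord p q i v : chart_dom p q ->
  mdiff q (chart_coord p i) v = mdiff q (chart p) v 0 i.
Proof. by move=> pq; exact: (diff_row_coord i v (transition_diff pq)). Qed.

Definition partial p f i : M -> R^o :=
  fun q => 'd (f \o chart_inv p) (chart p q) (delta_mx 0 i).

Lemma partial_smooth p q f i : chart_dom p q -> smooth_at f q -> smooth_at (partial p f i) q.
Proof.
move=> pq /(smooth_at_chartP _ pq) [ O [oO Oq sf]].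
apply: (@smooth_in_chart_comp _ _ _ p q (fun x =>
  'd (f \o chart_inv p) x (delta_mx 0 i)) O) => //.
by move=> k; exact: (sf k.+1).2.
Qed.

Lemma mdiff_partial p q f v : chart_dom p q -> smooth_at f q ->
  mdiff q f v = \sum_i partial p f i q * mdiff q (chart_coord p i) v.
Proof.
move=> pq sf; have [_ ->] := mdiff_change v pq (smooth_in_chart_diff pq sf).
rewrite row_diff_basis; apply: eq_bigr => i _.
by rewrite mdiff_chart_coord // mulrC.
Qed.

Definition der X f : M -> R^o := fun q => mdiff q f (X q).

(** Reduces smoothness of fields to that of scalar functions, where sums, products and changes of
    chart are available. *)
Lemma vsmooth_coordP X p : vsmooth_at X p <-> forall i, smooth_at (der X (chart_coord p i)) p.
Proof.
have E i : \forall q \near p, vcoord p X q 0 i = der X (chart_coord p i) q.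
  by apply: filterS (chart_dom_near (chart_dom_center p)) => q pq; rewrite /der mdiff_chart_coord.
split.
  move=> [ O [oO Op sX]] i; apply: (smooth_at_ext (E i)); exists O; split=> // k.
  exact: ((Ck_on_rowP k _ oO).1 (sX k) i).
move=> sX.
have {}sX i : smooth_at (fun q => vcoord p X q 0 i : R^o) p.
  by apply: smooth_at_ext (sX i); apply: filterS (E i) => q ->.
pose P i (O : set 'rV[R]_m) := [/\ open O, O (chart p p) &
  smooth_on O ((fun q => vcoord p X q 0 i : R^o) \o chart_inv p)].
have [U UP] : exists U, forall i, P i (U i) by exists (fun i => xget setT (P i)) => i;
  apply: xgetPex; exact: sX.
pose T := interior [set x | forall i, U i x].
have oT : open T by exact: open_interior.
have Tp : \forall x \near chart p p, forall i, U i x.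
  apply: (@filter_forall _ _ U (nbhs (chart p p)) _) => i; have [oU Up _] := UP i.
  exact: open_nbhs_nbhs.
exists T; split=> //.
move=> k; apply/(Ck_on_rowP k _ oT) => i; have [_ _ sU] := UP i.
by apply: Ck_on_sub (sU k) => x /interior_subset.
Qed.

(** Near q, X f is the sum of the partial derivatives of f in the chart p times the X x_i, x_i being
    the coordinates of that chart. *)
Lemma der_smooth_chart p q X f : chart_dom p q ->
  (forall i, smooth_at (der X (chart_coord p i)) q) -> smooth_at f q ->
  smooth_at (der X f) q.
Proof.
move=> pq sX sf.
apply: (@smooth_at_ext _ _ _ q (fun q => \sum_i partial p f i q * der X (chart_coord p i) q)).
  apply: filterS2 (chart_dom_near pq) (smooth_at_near sf) => q' pq' sf'.
  by rewrite /der (mdiff_partial _ pq' sf').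
apply: smooth_at_sum => i; apply: smooth_at_mul => //; exact: partial_smooth.
Qed.

Lemma vsmooth_chart p q X : chart_dom p q ->
  (forall i, smooth_at (der X (chart_coord p i)) q) -> vsmooth_at X q.
Proof.
move=> pq sX; apply/vsmooth_coordP => i; apply: (der_smooth_chart pq sX).
exact/chart_coord_smooth/chart_dom_center.
Qed.

Lemma der_smooth X f p : vsmooth_at X p -> smooth_at f p -> smooth_at (der X f) p.
Proof. move=> /vsmooth_coordP; exact/der_smooth_chart/chart_dom_center. Qed.

Lemma vsmooth_at_near X p : vsmooth_at X p -> \forall q \near p, vsmooth_at X q.
Proof.
move=> /vsmooth_coordP sX.
have n : \forall q \near p, forall i, smooth_at (der X (chart_coord p i)) q.
  by apply: (@filter_forall _ _ (fun i => smooth_at (der X (chart_coord p i)))) => i;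
    exact: smooth_at_near.
by apply: filterS2 (chart_dom_near (chart_dom_center p)) n => q; exact: vsmooth_chart.
Qed.

Lemma vsmooth_at_ext X Y p : (\forall q \near p, X q = Y q) -> vsmooth_at X p -> vsmooth_at Y p.
Proof.
move=> XY /vsmooth_coordP sX; apply/vsmooth_coordP => i; apply: smooth_at_ext (sX i).
by apply: filterS XY => q; rewrite /der => ->.
Qed.

Lemma vsmooth_at_add X Y p : vsmooth_at X p -> vsmooth_at Y p ->
  vsmooth_at (fun q => X q + Y q) p.
Proof.
move=> /vsmooth_coordP sX /vsmooth_coordP sY; apply/vsmooth_coordP => i.
by apply: smooth_at_ext (smooth_at_add (sX i) (sY i)); near=> q; rewrite /der mdiffD.
Unshelve. all: by end_near. Qed.

Lemma vsmooth_at_scale f X p : smooth_at f p -> vsmooth_at X p ->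
  vsmooth_at (fun q => f q *: X q) p.
Proof.
move=> sf /vsmooth_coordP sX; apply/vsmooth_coordP => i.
by apply: smooth_at_ext (smooth_at_mul sf (sX i)); near=> q; rewrite /der mdiffZ.
Unshelve. all: by end_near. Qed.

Lemma vsmooth_at0 p : vsmooth_at (fun=> 0 : 'rV[R]_m) p.
Proof.
apply/vsmooth_coordP => i; apply: smooth_at_ext (smooth_at_cst p 0).
by near=> q; rewrite /der mdiff0.
Unshelve. all: by end_near. Qed.

Lemma vsmooth_at_opp X p : vsmooth_at X p -> vsmooth_at (fun q => - X q) p.
Proof.
move=> sX; apply: vsmooth_at_ext (vsmooth_at_scale (smooth_at_cst p (-1 : R^o)) sX).
by near=> q; rewrite scaleN1r.
Unshelve. all: by end_near. Qed.

Lemma vsmooth_at_sub X Y p : vsmooth_at X p -> vsmooth_at Y p ->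
  vsmooth_at (fun q => X q - Y q) p.
Proof. by move=> sX /vsmooth_at_opp; exact: vsmooth_at_add. Qed.

Lemma vsmooth_at_sum p (I : Type) (s : seq I) (X : I -> vfield M) :
  (forall i, vsmooth_at (X i) p) -> vsmooth_at (fun q => \sum_(i <- s) X i q) p.
Proof.
move=> sX; elim: s => [|i s IH].
  by apply: vsmooth_at_ext (vsmooth_at0 p); near=> q; rewrite big_nil.
by apply: vsmooth_at_ext (vsmooth_at_add (sX i) IH); near=> q; rewrite big_cons.
Unshelve. all: by end_near. Qed.

Lemma vconst_diff p q : chart_dom p q ->
  differentiable (chart q \o chart_inv p) (chart p q).
Proof.
by move=> pq; apply: (chart_transition p q 1%N).1; exists q => //; split=> //;
  exact: chart_dom_center.
Qed.

Lemma mdiff_vconst p q u : chart_dom p q -> mdiff q (chart p) (vconst p u q) = u.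
Proof.
move=> pq; have [d e] := is_diff_id (chart p q).
have d1 := vconst_diff pq; have d2 := transition_diff pq.
have d2' : differentiable (chart p \o chart_inv q) ((chart q \o chart_inv p) (chart p q)).
  by rewrite /= chartK.
apply: etrans (congr1 (@^~ u) e).
have E : \forall x \near chart p q,
    id x = ((chart p \o chart_inv q) \o (chart q \o chart_inv p)) x.
  have n := near_chart_inv pq (chart_dom_near (chart_dom_center q)).
  by apply: filterS2 n (near_chart_invK pq) => x /chartK h h'; rewrite /= h h'.
apply: etrans (congr1 (@^~ u) (near_eq_diff E d)).
apply: etrans (esym (congr1 (@^~ u) (diff_comp d1 d2'))).
have xE : (chart q \o chart_inv p) (chart p q) = chart q q by rewrite /= chartK.
exact: (esym (congr1 (fun x => 'd (chart p \o chart_inv q) x (vconst p u q)) xE)).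
Qed.

Lemma vconst_mdiff p q v : chart_dom p q -> vconst p (mdiff q (chart p) v) q = v.
Proof.
move=> pq; have [_] := mdiff_change v pq (vconst_diff pq).
by rewrite mdiff_chart_self.
Qed.

Lemma vconst_smooth p q u : chart_dom p q -> vsmooth_at (vconst p u) q.
Proof.
move=> pq; apply: (vsmooth_chart pq) => i; apply: smooth_at_ext (smooth_at_cst q (u 0 i)).
by apply: filterS (chart_dom_near pq) => q' pq'; rewrite /der mdiff_chart_coord ?mdiff_vconst.
Qed.

Lemma vconstZ p q a u : vconst p (a *: u) q = a *: vconst p u q.
Proof. exact: linearZ. Qed.

Lemma vconst_sum p q (I : Type) (s : seq I) (u : I -> 'rV[R]_m) :
  vconst p (\sum_(i <- s) u i) q = \sum_(i <- s) vconst p (u i) q.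
Proof. exact: linear_sum. Qed.

Lemma vcoord_diff X p i v : vsmooth_at X p ->
  mdiff p (vcoord p X) v 0 i = mdiff p (der X (chart_coord p i)) v.
Proof.
move=> [ O [oO Op sX]]; have d : differentiable (vcoord p X \o chart_inv p) (chart p p).
  exact: ((sX 1%N).1 _ Op).
rewrite -[LHS](diff_row_coord i v d).
apply: esym; apply: (@mdiff_ext _ _ _ R^o p (fun q => vcoord p X q 0 i));
  last exact: differentiable_row_coord.
by apply: filterS (chart_dom_near (chart_dom_center p)) => q pq; rewrite /der mdiff_chart_coord.
Qed.

Lemma partial_sym p f i j : smooth_at f p ->
  mdiff p (partial p f i) (delta_mx 0 j) = mdiff p (partial p f j) (delta_mx 0 i).
Proof.
move=> [ O [oO Op sf]].
have A a v : mdiff p (partial p f a) v =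
    'd (fun x => 'd (f \o chart_inv p) x (delta_mx 0 a) : R^o) (chart p p) v.
  apply: (congr1 (@^~ v) (near_eq_diff _ _)); last exact: (((sf 2).2 _).1 _ Op).
  by apply: filterS (near_chart_invK (chart_dom_center p)) => x; rewrite /partial /= => ->.
by rewrite !A; exact: diff_diff_sym (sf 2).
Qed.

(** Links the coordinate formula that defines the bracket to the commutator of derivations. The
    second derivatives of f cancel by Schwarz. *)
Lemma lie_bracketE X Y f p : vsmooth_at X p -> vsmooth_at Y p -> smooth_at f p ->
  mdiff p f (lie_bracket X Y p) = mdiff p (der Y f) (X p) - mdiff p (der X f) (Y p).
Proof.
move=> sX sY sf; have pp := chart_dom_center p.
(* The derivative of Z f along v is the Hessian of f in the chart, applied to v and Z, plus df of
   the derivative of the components of Z along v. Only the second part survives in the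
   commutator. *)
have D Z v : vsmooth_at Z p -> mdiff p (der Z f) v =
    \sum_i \sum_j (v 0 j * Z p 0 i) * mdiff p (partial p f i) (delta_mx 0 j)
    + mdiff p f (mdiff p (vcoord p Z) v).
  move=> sZ; have sZi i := (vsmooth_coordP Z p).1 sZ i.
  have E : \forall q \near p, \sum_i partial p f i q * der Z (chart_coord p i) q = der Z f q.
    apply: filterS2 (chart_dom_near pp) (smooth_at_near sf) => q pq sfq.
    by rewrite /der (mdiff_partial _ pq sfq).
  have sP i : smooth_at (partial p f i) p by exact: partial_smooth.
  rewrite (smooth_mdiff_ext v E); last by apply: smooth_at_sum => i; exact: smooth_at_mul.
  rewrite mdiff_fsum; last by move=> i; exact: smooth_at_mul.
  rewrite (mdiff_partial _ pp sf) -big_split /=; apply: eq_bigr => i _.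
  rewrite mdiff_mul // [LHS]addrC; congr (_ + _).
    rewrite /der mdiff_chart_coord // mdiff_chart_self.
    rewrite {1}(row_sum_delta v) mdiff_sum mulr_sumr; apply: eq_bigr => j _.
    by rewrite mdiffZ -[_ *: _]/(_ * _) mulrCA mulrA.
  by rewrite mdiff_chart_coord // mdiff_chart_self vcoord_diff.
rewrite (D Y _ sY) (D X _ sX) /lie_bracket mdiffB.
have -> : \sum_i \sum_j (Y p 0 j * X p 0 i) * mdiff p (partial p f i) (delta_mx 0 j) =
  \sum_i \sum_j (X p 0 j * Y p 0 i) * mdiff p (partial p f i) (delta_mx 0 j).
  rewrite exchange_big /=; apply: eq_bigr => i _; apply: eq_bigr => j _.
  by rewrite partial_sym // [X in X * _]mulrC.
by rewrite opprD addrACA subrr add0r.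
Qed.

End VectorFields.

(** * Smooth maps and the chain rule *)

Section SmoothMaps.
Context {R : realType} {m n : nat} {M : manifold R m} {N : manifold R n}.
Variable psi : M -> N.
Hypothesis psi_smooth : smooth_map psi.

Lemma smooth_map_near p (P : set N) : (\forall q \near psi p, P q) ->
  \forall q \near p, P (psi q).
Proof. by move=> H; exact: (psi_smooth.1 p _ H). Qed.

Lemma smooth_at_comp p (f : N -> R^o) : smooth_at f (psi p) -> smooth_at (f \o psi : M -> R^o) p.
Proof.
move=> [ O [oO Op sf]]; have pp := chart_dom_center p.
have [ O' [oO' Op' sp]] := psi_smooth.2 p; set q0 := psi p in Op sf sp *.
pose A : set M := interior [set q | chart_dom q0 (psi q) /\ O (chart q0 (psi q))].
have Ap : A p.
  apply: (smooth_map_near (P := fun y => chart_dom q0 y /\ O (chart q0 y))).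
  apply: filterI; first exact/chart_dom_near/chart_dom_center.
  by apply: (chart_continuous (chart_dom_center q0)); exact: open_nbhs_nbhs.
pose T := O' `&` chart p @` (chart_dom p `&` A).
have oT : open T by apply: openI => //; apply/chart_image_open_sub/open_interior.
exists T; split; [exact: oT | by split=> //; exists p |] => k.
have sp' : Ck_on k T ((chart q0 \o psi) \o chart_inv p) by apply: Ck_on_sub (sp k) => x [].
have TO x : T x -> O (((chart q0 \o psi) \o chart_inv p) x).
  by move=> [_ [q [pq /interior_subset [_ Oq]] <-]]; rewrite /= chartK.
apply: (Ck_on_ext oT _ (Ck_on_comp_scalar oT TO sp' (sf k))).
by move=> x [_ [q [pq /interior_subset [dq _]] <-]]; rewrite /= !chartK.
Qed.

Lemma mdiff_comp p (f : N -> R^o) v : smooth_at f (psi p) ->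
  mdiff p (f \o psi : M -> R^o) v = mdiff (psi p) f (pushforward psi p v).
Proof.
move=> sf; have pp := chart_dom_center p; have qq := chart_dom_center (psi p).
have df := smooth_at_diff sf.
have [ O' [oO' Op' sp]] := psi_smooth.2 p.
have dp : differentiable ((chart (psi p) \o psi) \o chart_inv p) (chart p p).
  exact: ((sp 1%N).1 _ Op').
have xE : ((chart (psi p) \o psi) \o chart_inv p) (chart p p) = chart (psi p) (psi p).
  by rewrite /= chartK.
have df' : differentiable (f \o chart_inv (psi p)) (((chart (psi p) \o psi) \o chart_inv p)
  (chart p p)).
  by rewrite xE.
have E : \forall x \near chart p p,
    ((f \o chart_inv (psi p)) \o ((chart (psi p) \o psi) \o chart_inv p)) x =
    ((f \o psi) \o chart_inv p) x.
  have := near_chart_inv pp (smooth_map_near (chart_dom_near qq)).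
  by apply: filterS => x h; rewrite /= chartK.
apply: etrans (congr1 (@^~ v) (near_eq_diff E (differentiable_comp dp df'))) _.
apply: etrans (congr1 (@^~ v) (diff_comp dp df')) _.
exact: (congr1 (fun x => 'd (f \o chart_inv (psi p)) x (pushforward psi p v)) xE).
Qed.

Lemma pushforwardD p u v : pushforward psi p (u + v) = pushforward psi p u + pushforward psi p v.
Proof. exact: mdiffD. Qed.
Lemma pushforwardB p u v : pushforward psi p (u - v) = pushforward psi p u - pushforward psi p v.
Proof. exact: mdiffB. Qed.
Lemma pushforwardZ p a v : pushforward psi p (a *: v) = a *: pushforward psi p v.
Proof. exact: mdiffZ. Qed.
Lemma pushforward0 p : pushforward psi p 0 = 0.
Proof. exact: mdiff0. Qed.
Lemma pushforward_sum p (I : Type) (s : seq I) (v : I -> 'rV[R]_m) :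
  pushforward psi p (\sum_(i <- s) v i) = \sum_(i <- s) pushforward psi p (v i).
Proof. exact: mdiff_sum. Qed.
End SmoothMaps.

(** * Matrices with smooth entries *)

Section SmoothMatrices.
Context {R : realType} {m : nat} {M : manifold R m}.

Definition smooth_mx a b (A : M -> 'M[R]_(a, b)) (p : M) : Prop :=
  forall i j, smooth_at (fun q => A q i j : R^o) p.

Lemma smooth_mx_mul a b c (A : M -> 'M[R]_(a, b)) (B : M -> 'M[R]_(b, c)) p :
  smooth_mx A p -> smooth_mx B p -> smooth_mx (fun q => A q *m B q) p.
Proof.
move=> sA sB i j.
apply: (@smooth_at_ext _ _ _ _ (fun q => \sum_k A q i k * B q k j)).
  by near=> q; rewrite mxE.
by apply: smooth_at_sum => k; exact: smooth_at_mul.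
Unshelve. all: by end_near. Qed.

Lemma smooth_mx_tr a b (A : M -> 'M[R]_(a, b)) p : smooth_mx A p ->
  smooth_mx (fun q => (A q)^T) p.
Proof.
by move=> sA i j; apply: smooth_at_ext (sA j i); near=> q; rewrite mxE.
Unshelve. all: by end_near. Qed.

Lemma smooth_det a (A : M -> 'M[R]_a) p : smooth_mx A p ->
  smooth_at (fun q => \det (A q) : R^o) p.
Proof.
move=> sA; apply: smooth_at_sum => s; apply: smooth_at_mul; first exact: smooth_at_cst.
by apply: smooth_at_prod => i; exact: sA.
Qed.

(* 1 / f = f / f^2, which reduces the inverse to a power of a positive function. *)
Lemma smooth_at_inv p (f : M -> R^o) : f p != 0 -> smooth_at f p ->
  smooth_at (fun q => (f q)^-1 : R^o) p.
Proof.
move=> f0 sf; have f2 : 0 < f p * f p by rewrite -expr2 exprn_even_gt0.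
apply: smooth_at_ext (smooth_at_mul sf (smooth_at_powR (-1) f2 (smooth_at_mul sf sf))).
near=> q; rewrite powR_inv1 -?expr2 ?sqr_ge0 // expr2 invfM.
have [->|fq] := eqVneq (f q) 0; first by rewrite invr0 !mul0r.
by rewrite mulrA divff // mul1r.
Unshelve. all: by end_near. Qed.

(** Cramer's rule: the determinant stays nonzero near p, and there each entry of the inverse is a
    cofactor divided by it. *)
Lemma smooth_mx_inv a (A : M -> 'M[R]_a) p : smooth_mx A p -> A p \in unitmx ->
  smooth_mx (fun q => invmx (A q)) p.
Proof.
move=> sA uA i j; have sd := smooth_det sA.
have d0 : \det (A p) != 0 by rewrite -unitfE.
have dn : \forall q \near p, \det (A q) != 0.
  exact: (cvgr_neq0 (\det (A p)) (smooth_at_continuous sd)).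
apply: (@smooth_at_ext _ _ _ _ (fun q => (\det (A q))^-1 * \adj (A q) i j)).
  by apply: filterS dn => q dq; rewrite /invmx unitmxE unitfE dq [RHS]mxE.
apply: smooth_at_mul; first exact: smooth_at_inv.
apply: (@smooth_at_ext _ _ _ _ (fun q => cofactor (A q) j i)).
  by near=> q; rewrite mxE.
apply: smooth_at_mul; first exact: smooth_at_cst.
apply: smooth_det => k l.
by apply: smooth_at_ext (sA (lift j k) (lift i l)); near=> q; rewrite !mxE.
Unshelve. all: by end_near. Qed.
End SmoothMatrices.

(** * Global extension of fields that are constant in a chart *)

Section Extension.
Context {R : realType} {n : nat} {N : manifold R n}.

(** The delicate points are those outside the chart domain. The support is contained in C, the image
    under [chart_inv] of a compact set; C is compact, hence closed because the manifold is
    Hausdorff, and it lies in the chart domain. So a point outside the domain has a neighbourhood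
    that misses C, where the field is 0. *)
Lemma vconst_extension (y : N) : exists c : N -> R, [/\
   \forall q \near y, c q = 1 &
   forall u q, vsmooth_at (fun q => c q *: vconst y u q) q].
Proof.
have yy := chart_dom_center y.
have [|b [K [sb b1 cK KO bK]]] := @bump_function R n (chart y y) _ (@chart_image_open _ _ N y).
  by exists y.
pose c q : R := if `[< chart_dom y q >] then b (chart y q) else 0.
exists c; split.
  have n1 : \forall q \near y, b (chart y q) = 1 by exact: (@chart_continuous _ _ N y y yy _ b1).
  by apply: filterS2 (chart_dom_near yy) n1 => q yq bq; rewrite /c asboolT.
pose C := chart_inv y @` K.
have closedC : closed C.
  apply: compact_closed; first exact: manifold_hausdorff.
  apply: continuous_compact => //; apply: continuous_in_subspaceT => x.
  by rewrite inE => /KO im; exact: chart_inv_continuous.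
move=> u q; have [yq|yq] := pselect (chart_dom y q).
  have sc : smooth_at (b \o chart y) q.
    by apply: (@smooth_in_chart_comp _ _ _ y q b setT) => //; exact: openT.
  apply: vsmooth_at_ext (vsmooth_at_scale sc (vconst_smooth u yq)).
  by apply: filterS (chart_dom_near yq) => q' yq'; rewrite /c asboolT.
apply: vsmooth_at_ext (vsmooth_at0 q).
have : \forall q' \near q, (~` C) q'.
  apply: open_nbhs_nbhs; split; first exact: closed_openC.
  by move=> [x /KO [q' yq' <-]]; rewrite chartK // => qq; apply: yq; rewrite -qq.
apply: filterS => q' Cq'; rewrite /c; case: asboolP => [yq'|_]; last by rewrite scale0r.
rewrite bK ?scale0r // => Kq; apply: Cq'; exists (chart y q') => //; exact: chartK.
Qed.
End Extension.

(** * Horizontal lifts *)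

Section GramLift.
Context {R : realType}.

Lemma unitmx_inj n (A : 'M[R]_n) : (forall x : 'rV_n, x *m A = 0 -> x = 0) -> A \in unitmx.
Proof.
move=> inj; rewrite -row_free_unit -kermx_eq0; apply/eqP/row_matrixP => i.
by rewrite row0; apply: inj; rewrite -row_mul mulmx_ker row0.
Qed.

Section Form.
Variables (m n : nat) (G : 'rV[R]_m -> 'rV[R]_m -> R) (L : 'rV[R]_m -> 'rV[R]_n).
Hypothesis G_lin : forall a u v w, G (a *: u + v) w = a * G u w + G v w.
Hypothesis G_sym : forall u v, G u v = G v u.
Hypothesis G_pos : forall u, u != 0 -> 0 < G u u.
Hypothesis L_lin : forall a u v, L (a *: u + v) = a *: L u + L v.
Hypothesis L_surj : forall w, exists v, L v = w.
Variable E : 'I_m -> 'rV[R]_m.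
Hypothesis E_span : forall v, exists c : 'rV[R]_m, v = \sum_i c 0 i *: E i.
Hypothesis E_free : forall c : 'rV[R]_m, \sum_i c 0 i *: E i = 0 -> c = 0.

Let S : 'M[R]_m := \matrix_(i, j) G (E i) (E j).
Let P : 'M[R]_(m, n) := \matrix_(i, a) L (E i) 0 a.
Let comb (c : 'rV[R]_m) := \sum_i c 0 i *: E i.

Lemma L_comb c : L (comb c) = c *m P.
Proof.
have L0 : L 0 = 0 by have := L_lin (-1) 0 0; rewrite scaler0 addr0 scaleN1r addNr.
have -> : L (comb c) = \sum_i c 0 i *: L (E i).
  rewrite /comb; elim: (index_enum _) => [|i s IH]; first by rewrite !big_nil L0.
  by rewrite !big_cons L_lin IH.
by apply/rowP => a; rewrite summxE !mxE; apply: eq_bigr => i _; rewrite !mxE.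
Qed.

Lemma G_comb c d : G (comb c) (comb d) = (c *m S *m d^T) 0 0.
Proof.
have G0 w : G 0 w = 0 by have := G_lin (-1) 0 0 w; rewrite scaler0 addr0 mulN1r addNr.
have Gs e w : G (comb e) w = \sum_i e 0 i * G (E i) w.
  rewrite /comb; elim: (index_enum _) => [|i s IH]; first by rewrite !big_nil G0.
  by rewrite !big_cons G_lin IH.
rewrite Gs -mulmxA mxE; apply: eq_bigr => i _; rewrite G_sym Gs mxE; congr (_ * _).
by apply: eq_bigr => j _; rewrite !mxE G_sym mulrC.
Qed.

Lemma G_eq0 u : G u u = 0 -> u = 0.
Proof. by move=> Gu; apply/eqP; apply: contraT => /G_pos; rewrite Gu ltxx. Qed.

Lemma gram_unit : S \in unitmx.
Proof.
apply: unitmx_inj => c cS; apply: E_free; apply: G_eq0.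
by rewrite -/(comb c) G_comb cS mul0mx mxE.
Qed.

Lemma gram_tr : S^T = S.
Proof. by apply/matrixP => i j; rewrite !mxE G_sym. Qed.

(** With y = x P^T S^-1, the value x P^T S^-1 P x^T equals y S y^T, the squared G-norm of the vector
    with coefficients y. So x in the kernel gives y = 0, then x P^T = 0, and x = 0 because L is
    onto. *)
Lemma dual_gram_unit : P^T *m invmx S *m P \in unitmx.
Proof.
apply: unitmx_inj => x xA; pose y := x *m P^T *m invmx S.
have yS : y *m S = x *m P^T by rewrite mulmxKV ?gram_unit.
have y0 : y = 0.
  apply/E_free/G_eq0; rewrite -/(comb y) G_comb yS /y !trmx_mul trmxK trmx_inv gram_tr.
  by rewrite !mulmxA; move: xA; rewrite !mulmxA => ->; rewrite mul0mx mxE.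
have xP : x *m P^T = 0 by rewrite -yS y0 mul0mx.
apply/rowP => a; have [v vE] := L_surj (delta_mx 0 a); have [c cE] := E_span v.
have : x *m (delta_mx 0 a : 'rV_n)^T = 0.
  by rewrite -vE cE -/(comb c) L_comb trmx_mul mulmxA xP mul0mx.
move=> /matrixP/(_ 0 0); rewrite !mxE (bigD1 a) //= big1 ?addr0.
  by rewrite !mxE !eqxx mulr1.
by move=> i ia; rewrite !mxE (negbTE ia) andbF mulr0.
Qed.

(* Coordinates in the basis E of the G-orthogonal preimage of w under L. *)
Definition lift_coeffs (w : 'rV[R]_n) : 'rV[R]_m :=
  w *m invmx (P^T *m invmx S *m P) *m (P^T *m invmx S).

Lemma L_lift_coeffs w : L (comb (lift_coeffs w)) = w.
Proof. by rewrite L_comb /lift_coeffs -mulmxA mulmxKV // dual_gram_unit. Qed.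

Lemma G_lift_coeffs w v : L v = 0 -> G (comb (lift_coeffs w)) v = 0.
Proof.
have [d ->] := E_span v; rewrite -/(comb d) L_comb => dP.
rewrite G_comb /lift_coeffs -!mulmxA (mulmxA (invmx S)) mulVmx ?gram_unit // mul1mx.
by rewrite -trmx_mul dP trmx0 !mulmx0 mxE.
Qed.
End Form.
End GramLift.

Section MetricTheory.
Context {R : realType} {m : nat} {M : manifold R m} (g : metric M).
Implicit Types (p : M) (u v w : 'rV[R]_m).

Lemma metricDl p u v w : g p (u + v) w = g p u w + g p v w.
Proof. by have := metric_linear g p 1 u v w; rewrite scale1r mul1r. Qed.
Lemma metric0l p w : g p 0 w = 0.
Proof. by apply: (addrI (g p 0 w)); rewrite -metricDl !addr0. Qed.
Lemma metricZl p a u w : g p (a *: u) w = a * g p u w.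
Proof. by have := metric_linear g p a u 0 w; rewrite addr0 metric0l addr0. Qed.
Lemma metricNl p u w : g p (- u) w = - g p u w.
Proof. by rewrite -scaleN1r metricZl mulN1r. Qed.
Lemma metricBl p u v w : g p (u - v) w = g p u w - g p v w.
Proof. by rewrite metricDl metricNl. Qed.
Lemma metricZr p a u w : g p u (a *: w) = a * g p u w.
Proof. by rewrite !(metric_sym g p u) metricZl. Qed.
Lemma metricBr p u v w : g p u (v - w) = g p u v - g p u w.
Proof. by rewrite !(metric_sym g p u) metricBl. Qed.
Lemma metric_suml p (I : Type) (s : seq I) (u : I -> 'rV[R]_m) w :
  g p (\sum_(i <- s) u i) w = \sum_(i <- s) g p (u i) w.
Proof.
elim: s => [|i s IH]; first by rewrite !big_nil metric0l.
by rewrite !big_cons metricDl IH.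
Qed.
Lemma metric_sumr p (I : Type) (s : seq I) (u : I -> 'rV[R]_m) w :
  g p w (\sum_(i <- s) u i) = \sum_(i <- s) g p w (u i).
Proof. by rewrite metric_sym metric_suml; apply: eq_bigr => i _; exact: metric_sym. Qed.
Lemma metric_ge0 p u : 0 <= g p u u.
Proof. by have [->|/(metric_pos g p)/ltW//] := eqVneq u 0; rewrite metric0l. Qed.
Lemma metric_eq0 p u : g p u u = 0 -> u = 0.
Proof. by move=> gu; apply/eqP; apply: contraT => /(metric_pos g p); rewrite gu ltxx. Qed.
End MetricTheory.

(** * Horizontal lifts along a Riemannian submersion *)

Section RiemannianSubmersion.
Context {R : realType} {m n : nat} {M : manifold R m} {N : manifold R n}.
Context {g : metric M} {gN : metric N} {psi : M -> N}.
Hypothesis sub : riemannian_submersion g gN psi.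

Lemma submersion_smooth : smooth_map psi. Proof. by have [] := sub. Qed.

Lemma pushforward_surj p w : exists v, pushforward psi p v = w.
Proof. by have [_ + _] := sub; apply. Qed.

Lemma metric_pushforward p u v : horizontal g psi p u -> horizontal g psi p v ->
  gN (psi p) (pushforward psi p u) (pushforward psi p v) = g p u v.
Proof. by have [_ _] := sub; apply. Qed.

Lemma horizontalD p u v : horizontal g psi p u -> horizontal g psi p v ->
  horizontal g psi p (u + v).
Proof. by move=> hu hv w vw; rewrite metricDl hu ?hv ?addr0. Qed.
Lemma horizontalZ p a u : horizontal g psi p u -> horizontal g psi p (a *: u).
Proof. by move=> hu w vw; rewrite metricZl hu ?mulr0. Qed.
Lemma horizontal0 p : horizontal g psi p 0.
Proof. by move=> w _; rewrite metric0l. Qed.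
Lemma horizontalB p u v : horizontal g psi p u -> horizontal g psi p v ->
  horizontal g psi p (u - v).
Proof. by move=> hu hv; rewrite -scaleN1r; apply: horizontalD => //; exact: horizontalZ. Qed.
Lemma horizontal_sum p (I : Type) (s : seq I) (u : I -> 'rV[R]_m) :
  (forall i, horizontal g psi p (u i)) -> horizontal g psi p (\sum_(i <- s) u i).
Proof. by move=> hu; elim/big_ind : _ => // [|x y]; [exact: horizontal0|exact: horizontalD]. Qed.

Lemma horizontal_inj p u v : horizontal g psi p u -> horizontal g psi p v ->
  pushforward psi p u = pushforward psi p v -> u = v.
Proof.
move=> hu hv uv; apply/eqP; rewrite -subr_eq0; apply/eqP/(@metric_eq0 _ _ _ g p).
by apply: (horizontalB hu hv); rewrite /vertical pushforwardB uv subrr.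
Qed.

Section Lift.
Variables (p q : M) (y : N).
Hypotheses (pq : chart_dom p q) (yq : chart_dom y (psi q)).

Let E (i : 'I_m) : 'rV[R]_m := vconst p (delta_mx 0 i) q.
Let L (v : 'rV[R]_m) : 'rV[R]_n := mdiff (psi q) (chart y) (pushforward psi q v).

Lemma vconst_comb (c : 'rV[R]_m) : \sum_i c 0 i *: vconst p (delta_mx 0 i) q = vconst p c q.
Proof.
rewrite [in RHS](row_sum_delta c) vconst_sum.
by apply: eq_bigr => i _; rewrite vconstZ.
Qed.

Let E_span v : exists c : 'rV[R]_m, v = \sum_i c 0 i *: E i.
Proof. by exists (mdiff q (chart p) v); rewrite vconst_comb vconst_mdiff. Qed.

Let E_free (c : 'rV[R]_m) : \sum_i c 0 i *: E i = 0 -> c = 0.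
Proof. by rewrite vconst_comb => c0; rewrite -(mdiff_vconst c pq) c0 mdiff0. Qed.

Let L_lin a u v : L (a *: u + v) = a *: L u + L v.
Proof. by rewrite /L pushforwardD pushforwardZ mdiffD mdiffZ. Qed.

Let L_surj w : exists v, L v = w.
Proof.
have [v vE] := pushforward_surj q (vconst y w (psi q)).
by exists v; rewrite /L vE mdiff_vconst.
Qed.

Definition hlift_coeffs (w : 'rV[R]_n) : 'rV[R]_m :=
  lift_coeffs (g q) L E (mdiff (psi q) (chart y) w).

Lemma hlift_coeffs_units :
  (\matrix_(i, j) g q (E i) (E j) : 'M[R]_m) \in unitmx /\
  ((\matrix_(i, a) L (E i) 0 a : 'M[R]_(m, n))^T *m invmx (\matrix_(i, j) g q (E i) (E j))
    *m (\matrix_(i, a) L (E i) 0 a)) \in unitmx.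
Proof.
have gl := metric_linear g q; have gs := metric_sym g q; have gp := metric_pos g q.
by split; [exact: (gram_unit gl gs gp E_free)|exact: (dual_gram_unit gl gs gp L_lin L_surj
  E_span E_free)].
Qed.

Lemma hlift_coeffsP w : horizontal g psi q (vconst p (hlift_coeffs w) q) /\
  pushforward psi q (vconst p (hlift_coeffs w) q) = w.
Proof.
have gl := metric_linear g q; have gs := metric_sym g q; have gp := metric_pos g q.
rewrite -vconst_comb; split.
  move=> v vv; apply: (G_lift_coeffs gl gs gp L_lin E_span E_free).
  by rewrite /L vv mdiff0.
rewrite -[RHS](vconst_mdiff _ yq) -[LHS](vconst_mdiff _ yq); congr (vconst y _ _).
exact: (L_lift_coeffs gl gs gp L_lin L_surj E_span E_free).
Qed.
End Lift.

Lemma hliftP p w : horizontal g psi p (hlift g psi p w) /\ pushforward psi p (hlift g psi p w)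
  = w.
Proof.
have ex : exists h, [set h | horizontal g psi p h /\ pushforward psi p h = w] h.
  exists (vconst p (hlift_coeffs p p (psi p) w) p).
  by apply: hlift_coeffsP; exact: chart_dom_center.
exact: (xgetPex 0 ex).
Qed.

Lemma hlift_horizontal p w : horizontal g psi p (hlift g psi p w).
Proof. by have [] := hliftP p w. Qed.

Lemma pushforward_hlift p w : pushforward psi p (hlift g psi p w) = w.
Proof. by have [] := hliftP p w. Qed.

Lemma hliftE p u : horizontal g psi p u -> hlift g psi p (pushforward psi p u) = u.
Proof.
by move=> hu; apply: horizontal_inj hu _; [exact: hlift_horizontal|rewrite pushforward_hlift].
Qed.

(** The horizontal part of v is the horizontal vector with the same image as v. This reduces the
    projections to lifts, so that one smoothness result serves both. *)
Lemma hprojE p v : hproj g psi p v = hlift g psi p (pushforward psi p v).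
Proof.
have ex : exists h, [set h | horizontal g psi p h /\ vertical psi p (v - h)] h.
  exists (hlift g psi p (pushforward psi p v)); split; first exact: hlift_horizontal.
  by rewrite /vertical pushforwardB pushforward_hlift subrr.
have [] : [set h | horizontal g psi p h /\ vertical psi p (v - h)] (hproj g psi p v).
  exact: (xgetPex 0 ex).
rewrite /vertical pushforwardB => hh /eqP; rewrite subr_eq0 => /eqP ->.
by rewrite hliftE.
Qed.

Lemma pushforward_coord_smooth p y a : chart_dom y (psi p) ->
  smooth_at (chart_coord y a \o psi) p.
Proof. by move=> yp; apply: (smooth_at_comp submersion_smooth); exact: chart_coord_smooth. Qed.

Lemma mdiff_coord_comp p y a v : chart_dom y (psi p) ->
  mdiff p (chart_coord y a \o psi) v = mdiff (psi p) (chart y) (pushforward psi p v) 0 a.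
Proof.
move=> yp; rewrite (mdiff_comp submersion_smooth v (chart_coord_smooth a yp)).
exact: mdiff_chart_coord.
Qed.

(** In fixed charts p on M and y on N, the lift at q has coefficients made of products and inverses
    of three matrices: the Gram matrix S of the coordinate fields, the matrix P of the differential
    of psi and the components w of the field on N. All three depend smoothly on q. *)
Lemma hlift_smooth p (XN : vfield N) : vsmooth_at XN (psi p) ->
  vsmooth_at (fun q => hlift g psi q (XN (psi q))) p.
Proof.
move=> sX; have pp := chart_dom_center p; set y := psi p; have yy := chart_dom_center y.
have ny : \forall q \near p, chart_dom y (psi q).
  exact: (smooth_map_near submersion_smooth (chart_dom_near yy)).
pose S q : 'M[R]_m := \matrix_(i, j) g q (vconst p (delta_mx 0 i) q) (vconst p (delta_mx 0 j) q).
pose P q : 'M[R]_(m, n) := \matrix_(i, a)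
  mdiff (psi q) (chart y) (pushforward psi q (vconst p (delta_mx 0 i) q)) 0 a.
pose w q : 'rV[R]_n := mdiff (psi q) (chart y) (XN (psi q)).
have sS : smooth_mx S p.
  move=> i j; apply: smooth_at_ext (metric_smooth g (vconst_smooth (delta_mx 0 i) pp)
    (vconst_smooth (delta_mx 0 j) pp)).
  by near=> q; rewrite mxE.
have sP : smooth_mx P p.
  move=> i a; apply: smooth_at_ext (der_smooth (vconst_smooth (delta_mx 0 i) pp)
    (pushforward_coord_smooth a yy)).
  by apply: filterS ny => q yq; rewrite mxE /der mdiff_coord_comp.
have sw : smooth_mx w p.
  move=> i a; rewrite (ord1 i).
  apply: smooth_at_ext (smooth_at_comp submersion_smooth (der_smooth sX (chart_coord_smooth a
    yy))).
  by apply: filterS ny => q yq; rewrite /= /der /w mdiff_chart_coord.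
have [uS uP] := hlift_coeffs_units pp yy.
have sPS : smooth_mx (fun q => (P q)^T *m invmx (S q)) p.
  apply: smooth_mx_mul; [exact: smooth_mx_tr | exact: smooth_mx_inv].
have sc : smooth_mx (fun q => w q *m invmx ((P q)^T *m invmx (S q) *m P q) *m ((P q)^T *m invmx
  (S q))) p.
  apply: smooth_mx_mul => //; apply: smooth_mx_mul => //; apply: smooth_mx_inv => //.
  exact: smooth_mx_mul.
apply: vsmooth_at_ext (vsmooth_at_sum (index_enum 'I_m)
  (fun i => vsmooth_at_scale (sc 0 i) (vconst_smooth (delta_mx 0 i) pp))).
apply: filterS2 ny (chart_dom_near pp) => q yq pq.
rewrite vconst_comb -/(lift_coeffs _ _ _ _).
have [hh hw] := hlift_coeffsP pq yq (XN (psi q)).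
by apply: (@horizontal_inj q) => //; rewrite ?hw ?pushforward_hlift //; exact: hlift_horizontal.
Unshelve. all: by end_near. Qed.

End RiemannianSubmersion.

(** * Curvature of basic fields *)

Section ConnectionTheory.
Context {R : realType} {m : nat} {M : manifold R m} (D : connection M).
Implicit Types (p : M) (u v : 'rV[R]_m) (X Y Z : vfield M).

Lemma nablaDl p u v Y : vsmooth_at Y p -> D p (u + v) Y = D p u Y + D p v Y.
Proof. by move=> sY; have := nabla_linear D 1 u v sY; rewrite !scale1r. Qed.
Lemma nabla0l p Y : vsmooth_at Y p -> D p 0 Y = 0.
Proof. by move=> sY; apply: (addrI (D p 0 Y)); rewrite -nablaDl // !addr0. Qed.
Lemma nablaZl p a u Y : vsmooth_at Y p -> D p (a *: u) Y = a *: D p u Y.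
Proof. by move=> sY; have := nabla_linear D a u 0 sY; rewrite nabla0l // !addr0. Qed.
Lemma nablaBl p u v Y : vsmooth_at Y p -> D p (u - v) Y = D p u Y - D p v Y.
Proof. by move=> sY; rewrite nablaDl // -scaleN1r nablaZl // scaleN1r. Qed.
Lemma nabla_suml p (I : Type) (s : seq I) (u : I -> 'rV[R]_m) Y : vsmooth_at Y p ->
  D p (\sum_(i <- s) u i) Y = \sum_(i <- s) D p (u i) Y.
Proof.
move=> sY; elim: s => [|i s IH]; first by rewrite !big_nil nabla0l.
by rewrite !big_cons nablaDl // IH.
Qed.

Lemma nabla0r p u : D p u (fun=> 0) = 0.
Proof.
have := nabla_add D u (vsmooth_at0 p) (vsmooth_at0 p).
rewrite (_ : (fun _ => _) = fun=> 0); last by apply/funext => q; rewrite addr0.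
by rewrite -[LHS]addr0 => /addrI.
Qed.

Lemma nabla_comb p u (I : Type) (s : seq I) (c : I -> M -> R^o) (Y : I -> vfield M) :
  (forall i, smooth_at (c i) p) -> (forall i, vsmooth_at (Y i) p) ->
  D p u (fun q => \sum_(i <- s) c i q *: Y i q) =
  \sum_(i <- s) ((mdiff p (c i) u : R) *: Y i p + (c i p : R) *: D p u (Y i)).
Proof.
move=> sc sY; elim: s => [|i s IH].
  rewrite big_nil (_ : (fun _ => _) = fun=> 0) ?nabla0r //.
  by apply/funext => q; rewrite big_nil.
rewrite big_cons -IH -nabla_leibniz // -nabla_add.
- by congr (D p u _); apply/funext => q; rewrite big_cons.
- exact: vsmooth_at_scale.
- by apply: vsmooth_at_sum => j; exact: vsmooth_at_scale.
Qed.

Lemma cov_smooth X Y p : vsmooth_at X p -> vsmooth_at Y p -> vsmooth_at (cov D X Y) p.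
Proof. exact: nabla_smooth. Qed.

End ConnectionTheory.

Section StatisticalSubmersion.
Context {R : realType} {m n : nat} {M : manifold R m} {N : manifold R n}.
Context {D : connection M} {g : metric M} {DN : connection N} {gN : metric N} {psi : M -> N}.
Hypothesis statM : statistical D g.
Hypothesis statN : statistical DN gN.
Hypothesis ssub : statistical_submersion D g DN gN psi.

Let sub : riemannian_submersion g gN psi. Proof. by case: ssub. Qed.

(** The vertical part of v does not pair with w, so the isometry of psi on horizontal vectors
    applies although v is arbitrary. Pairings with horizontal vectors are thereby moved to N. *)
Lemma metric_horizontal p v w : horizontal g psi p w ->
  g p v w = gN (psi p) (pushforward psi p v) (pushforward psi p w).
Proof.
move=> hw; have hv := hlift_horizontal sub (p:=p) (pushforward psi p v).
rewrite -[pushforward psi p v in RHS](pushforward_hlift sub p) (metric_pushforward sub) //.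
apply/eqP; rewrite -subr_eq0 -metricBl metric_sym hw //.
by rewrite /vertical pushforwardB (pushforward_hlift sub) subrr.
Qed.

Lemma vertical_vproj p v : vertical psi p (vproj g psi p v).
Proof. by rewrite /vertical /vproj (hprojE sub) pushforwardB (pushforward_hlift sub) subrr. Qed.

Lemma metric_vertical p v u : vertical psi p v -> g p v u = g p v (vproj g psi p u).
Proof.
move=> vv; rewrite /vproj metricBr (hprojE sub) (metric_sym g p v (hlift _ _ _ _)).
by rewrite (hlift_horizontal sub) ?subr0.
Qed.

Lemma hlift_basic (XN : vfield N) : (forall q, vsmooth_at XN q) ->
  basic g psi (fun p => hlift g psi p (XN (psi p))) XN.
Proof.
move=> sX; split=> // [p _|p]; last exact: (pushforward_hlift sub).
by split; [exact: (hlift_smooth sub)|exact: (hlift_horizontal sub)].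
Qed.

Section Basic.
Variables (X : vfield M) (XN : vfield N).
Hypothesis bX : basic g psi X XN.

Lemma basic_smooth p : vsmooth_at X p.
Proof. by have [h _ _] := bX; have [] := h p I. Qed.
Lemma basic_horizontal p : horizontal g psi p (X p).
Proof. by have [h _ _] := bX; have [] := h p I. Qed.
Lemma basic_smoothN q : vsmooth_at XN q.
Proof. by have [_ h _] := bX. Qed.
Lemma basic_pushforward p : pushforward psi p (X p) = XN (psi p).
Proof. by have [_ _ h] := bX. Qed.

(** Test on f o psi with f a coordinate function on N: V (f o psi) vanishes near p, and X (f o psi)
    = (XN f) o psi is again annihilated by V. *)
Lemma lie_bracket_vertical (V : vfield M) p : vsmooth_at V p ->
  (\forall q \near p, vertical psi q (V q)) -> pushforward psi p (lie_bracket V X p) = 0.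
Proof.
move=> sV vV; set y := psi p; have yy := chart_dom_center y.
have ny : \forall q \near p, chart_dom y (psi q).
  exact: (smooth_map_near (submersion_smooth sub) (chart_dom_near yy)).
apply/rowP => a; rewrite mxE -[pushforward _ _ _](mdiff_chart_self y).
have sf := pushforward_coord_smooth sub a yy.
rewrite -(mdiff_coord_comp sub a _ yy) (lie_bracketE sV (basic_smooth p) sf).
have E0 : \forall q \near p, (fun=> 0 : R^o) q = der V (chart_coord y a \o psi) q.
  by apply: filterS2 ny vV => q yq vq; rewrite /der (mdiff_coord_comp sub) // vq mdiff0 mxE.
have E1 : \forall q \near p, (der XN (chart_coord y a) \o psi) q = der X (chart_coord y a \o
  psi) q.
  apply: filterS ny => q yq.
  by rewrite /der (mdiff_coord_comp sub) // basic_pushforward /= /der mdiff_chart_coord.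
have sX := der_smooth (basic_smoothN y) (chart_coord_smooth a yy).
rewrite (smooth_mdiff_ext _ E0 (smooth_at_cst p 0)) mdiff_cst subr0.
rewrite (smooth_mdiff_ext _ E1 (smooth_at_comp (submersion_smooth sub) sX)).
by rewrite (mdiff_comp (submersion_smooth sub) _ sX) (nbhs_singleton vV) mdiff0.
Qed.

Lemma pushforward_cov_swap (V : vfield M) p : vsmooth_at V p ->
  (\forall q \near p, vertical psi q (V q)) ->
  pushforward psi p (cov D V X p) = pushforward psi p (cov D X V p).
Proof.
move=> sV vV; apply/eqP; rewrite -subr_eq0 -pushforwardB.
by rewrite (statM.1 _ _ _ sV (basic_smooth p)) lie_bracket_vertical.
Qed.
End Basic.

(* In terms of the dual connection this says A*_X W = - A_W X. *)
Lemma metric_cov_vertical X XN W WN (V : vfield M) p : basic g psi X XN -> basic g psi W WN ->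
  vsmooth_at V p -> (\forall q \near p, vertical psi q (V q)) ->
  g p (cov D X V p) (W p) = g p (V p) (cov D W X p).
Proof.
move=> bX bW sV vV; have vp := nbhs_singleton vV.
have sX := basic_smooth bX p; have sW := basic_smooth bW p.
have := statM.2 p V W X sV sW sX; rewrite /cov_metric.
have E1 : (fun q => g q (W q) (X q) : R^o) = (fun y => gN y (WN y) (XN y)) \o psi.
  apply/funext => q /=; rewrite metric_horizontal; last exact: (basic_horizontal bX).
  by rewrite (basic_pushforward bX) (basic_pushforward bW).
have sN := metric_smooth gN (basic_smoothN bW (psi p)) (basic_smoothN bX (psi p)).
rewrite E1 (mdiff_comp (submersion_smooth sub) _ sN) vp mdiff0 sub0r.
have E2 : \forall q \near p, (fun=> 0 : R^o) q = g q (V q) (X q).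
  by apply: filterS vV => q vq; rewrite metric_sym (basic_horizontal bX).
rewrite (smooth_mdiff_ext _ E2 (smooth_at_cst p 0)) mdiff_cst sub0r.
have swap Y YN Z ZN : basic g psi Y YN -> basic g psi Z ZN ->
    g p (cov D V Y p) (Z p) = g p (cov D Y V p) (Z p).
  move=> bY bZ; rewrite !(metric_horizontal _ (basic_horizontal bZ (p:=p))).
  by rewrite (pushforward_cov_swap bY sV vV).
(* Both derivative terms are gone. Replacing nabla_V W by nabla_W V makes the pairings with X on the
   two sides equal, and g(W, nabla_V X) = g(V, nabla_W X) remains. *)
rewrite (swap _ _ _ _ bW bX) => /addrI /oppr_inj.
by rewrite metric_sym (swap _ _ _ _ bX bW) => ->.
Qed.

(* A_X Y, when X and Y are horizontal. *)
Definition covV (X Y : vfield M) : vfield M := fun q => vproj g psi q (cov D X Y q).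

(** Compatibility of psi with the connections identifies the horizontal part as the lift of a smooth
    field on N. It can therefore be differentiated as a basic field once more, and the vertical part
    is smooth as a difference of smooth fields. *)
Lemma cov_decomp X XN Y YN : basic g psi X XN -> basic g psi Y YN ->
  exists H : vfield M, [/\ basic g psi H (cov DN XN YN),
    cov D X Y = (fun q => H q + covV X Y q) & forall q, vsmooth_at (covV X Y) q].
Proof.
move=> bX bY; exists (fun q => hlift g psi q (cov DN XN YN (psi q))).
have sN q : vsmooth_at (cov DN XN YN) q.
  by apply: cov_smooth; [exact: (basic_smoothN bX)|exact: (basic_smoothN bY)].
have bH := hlift_basic sN.
have E q : hproj g psi q (cov D X Y q) = hlift g psi q (cov DN XN YN (psi q)).
  by rewrite (hprojE sub) (ssub.2 _ _ _ _ bX bY).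
split=> //.
  by apply/funext => q; rewrite /covV /vproj E addrC subrK.
move=> q; apply: vsmooth_at_ext (vsmooth_at_sub (cov_smooth D (basic_smooth bX q) (basic_smooth
  bY q))
  (basic_smooth bH q)).
by near=> q'; rewrite /covV /vproj E.
Unshelve. all: by end_near. Qed.

Lemma covV_near X Y (p : M) : \forall q \near p, vertical psi q (covV X Y q).
Proof. by near=> q; exact: vertical_vproj. Unshelve. all: by end_near. Qed.

(** The horizontal part of nabla_Y Z contributes the term on N. For its vertical part,
    [metric_cov_vertical] moves the derivative from A_Y Z onto X. *)
Lemma metric_cov_cov X XN Y YN Z ZN W WN p :
  basic g psi X XN -> basic g psi Y YN -> basic g psi Z ZN -> basic g psi W WN ->
  g p (cov D X (cov D Y Z) p) (W p) =
    gN (psi p) (cov DN XN (cov DN YN ZN) (psi p)) (WN (psi p))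
    + g p (covV Y Z p) (covV W X p).
Proof.
move=> bX bY bZ bW; have [H [bH E sV]] := cov_decomp bY bZ.
rewrite {1}/cov E nabla_add //; last exact: (basic_smooth bH).
rewrite metricDl; congr (_ + _).
  rewrite (metric_horizontal _ (basic_horizontal bW (p:=p))) (basic_pushforward bW).
  by rewrite -/(cov D X H p) (ssub.2 _ _ _ _ bX bH).
rewrite -/(cov D X _ p) (metric_cov_vertical bX bW (sV p) (covV_near _ _ p)).
by rewrite metric_vertical //; exact: vertical_vproj.
Qed.

(** Treats the bracket term of the curvature, which torsion freeness splits into the directions
    nabla_X Y and nabla_Y X. For the vertical part V of the direction, nabla_V Z and nabla_Z V have
    the same pairing with W, so [metric_cov_vertical] applies again. *)
Lemma metric_cov_direction X XN Y YN Z ZN W WN p :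
  basic g psi X XN -> basic g psi Y YN -> basic g psi Z ZN -> basic g psi W WN ->
  g p (D p (cov D X Y p) Z) (W p) =
    gN (psi p) (DN (psi p) (cov DN XN YN (psi p)) ZN) (WN (psi p))
    + g p (covV X Y p) (covV W Z p).
Proof.
move=> bX bY bZ bW; have [H [bH E sV]] := cov_decomp bX bY.
rewrite (congr1 (@^~ p) E) nablaDl; last exact: (basic_smooth bZ).
rewrite metricDl; congr (_ + _).
  rewrite (metric_horizontal _ (basic_horizontal bW (p:=p))) (basic_pushforward bW).
  by rewrite -/(cov D H Z p) (ssub.2 _ _ _ _ bH bZ).
rewrite -/(cov D (covV X Y) Z p) (metric_horizontal _ (basic_horizontal bW (p:=p))).
rewrite (pushforward_cov_swap bZ (sV p) (covV_near _ _ p)).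
rewrite -(metric_horizontal _ (basic_horizontal bW (p:=p))).
rewrite (metric_cov_vertical bZ bW (sV p) (covV_near _ _ p)).
by rewrite metric_vertical //; exact: vertical_vproj.
Qed.

Section Curvature.
Variables (X Y Z W : vfield M) (XN YN ZN WN : vfield N).
Hypotheses (bX : basic g psi X XN) (bY : basic g psi Y YN) (bZ : basic g psi Z ZN)
  (bW : basic g psi W WN).

Lemma curvature_basic p :
  g p (curvature D X Y Z p) (W p) =
    gN (psi p) (curvature DN XN YN ZN (psi p)) (WN (psi p))
    + g p (covV Y Z p) (covV W X p) - g p (covV X Z p) (covV W Y p)
    - g p (covV X Y p - covV Y X p) (covV W Z p).
Proof.
have sX := basic_smooth bX p; have sY := basic_smooth bY p; have sZ := basic_smooth bZ p.
have sXN := basic_smoothN bX (psi p); have sYN := basic_smoothN bY (psi p).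
have sZN := basic_smoothN bZ (psi p).
rewrite /curvature -[cov D (lie_bracket X Y) Z p]/(D p (lie_bracket X Y p) Z).
rewrite -[cov DN _ ZN _]/(DN (psi p) (lie_bracket XN YN (psi p)) ZN).
rewrite -(statM.1 _ _ _ sX sY) nablaBl //.
rewrite -(statN.1 _ _ _ sXN sYN) nablaBl //.
rewrite 3![in LHS]metricBl 3!(metricBl gN) (metricBl g p (covV X Y p)).
rewrite (metric_cov_cov _ bX bY bZ bW) (metric_cov_cov _ bY bX bZ bW).
rewrite (metric_cov_direction _ bX bY bZ bW) (metric_cov_direction _ bY bX bZ bW).
by ring.
Qed.
End Curvature.
End StatisticalSubmersion.

(** * Tensoriality *)

Section CurvatureTensor.
Context {R : realType} {m : nat} {M : manifold R m} (D : connection M).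
Hypothesis tf : torsion_free D.
Implicit Types (p : M) (X Y Z : vfield M).

Lemma cov_ext X X' Y Y' p : X p = X' p -> vsmooth_at Y p ->
  (\forall q \near p, Y q = Y' q) -> cov D X Y p = cov D X' Y' p.
Proof.
move=> XX' sY YY'; rewrite /cov XX'; apply: nabla_local => //.
exact: vsmooth_at_ext YY' sY.
Qed.

(** The curvature differentiates nabla_X Y once more, so agreement at p alone would not suffice. *)
Lemma cov_near X X' Y Y' p : vsmooth_at Y p ->
  (\forall q \near p, X q = X' q) -> (\forall q \near p, Y q = Y' q) ->
  \forall q \near p, cov D X Y q = cov D X' Y' q.
Proof.
move=> sY XX' /near_join YY'.
near=> q; apply: cov_ext; [by near: q| |by near: q].
by near: q; exact: vsmooth_at_near.
Unshelve. all: by end_near. Qed.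

Lemma curvature_ext X X' Y Y' Z Z' p :
  vsmooth_at X p -> vsmooth_at Y p -> vsmooth_at Z p ->
  (\forall q \near p, X q = X' q) -> (\forall q \near p, Y q = Y' q) ->
  (\forall q \near p, Z q = Z' q) ->
  curvature D X Y Z p = curvature D X' Y' Z' p.
Proof.
move=> sX sY sZ XX YY ZZ.
have sX' := vsmooth_at_ext XX sX; have sY' := vsmooth_at_ext YY sY.
rewrite /curvature; congr (_ - _ - _).
- apply: cov_ext (nbhs_singleton XX) (cov_smooth D sY sZ) _; exact: cov_near.
- apply: cov_ext (nbhs_singleton YY) (cov_smooth D sX sZ) _; exact: cov_near.
- apply: cov_ext => //; rewrite -(tf sX sY) -(tf sX' sY').
  by congr (_ - _); [exact: cov_ext (nbhs_singleton XX) sY YY | exact: cov_ext (nbhs_singleton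
    YY) sX XX].
Qed.

Lemma curvature_antisym X Y Z p : vsmooth_at Z p -> curvature D X Y Z p = - curvature D Y X Z p.
Proof.
move=> sZ; rewrite /curvature.
have -> : cov D (lie_bracket X Y) Z p = - cov D (lie_bracket Y X) Z p.
  have -> : cov D (lie_bracket X Y) Z p = D p (- lie_bracket Y X p) Z.
    by rewrite /cov /lie_bracket opprB.
  by rewrite -scaleN1r nablaZl // scaleN1r.
by rewrite opprK !opprB addrC.
Qed.

Lemma congr_sub3 (V : zmodType) (a b c a' b' c' : V) :
  a = a' -> b = b' -> c = c' -> a - b - c = a' - b' - c'.
Proof. by move=> -> -> ->. Qed.

(** Expansion of Rie(X, Y)(c F) by the Leibniz rule, with a = X(Y c), b = Y(X c), x = X c, y = Y c,
    GX = nabla_X F, GY = nabla_Y F and B = nabla_[X, Y] F. The factor a - b is [X, Y] c. *)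
Lemma second_leibniz_identity (a b x y c : R) (F GX GY XY YX B : 'rV[R]_m) :
  (a *: F + y *: GX + (x *: GY + c *: XY)) - (b *: F + x *: GY + (y *: GX + c *: YX))
  - ((a - b) *: F + c *: B) = c *: (XY - YX - B).
Proof. by apply/rowP => j; rewrite !mxE; ring. Qed.

Section Comb.
Context {I : finType} (c : I -> M -> R^o) (F : I -> vfield M) (p : M).
Hypothesis sc : forall i, smooth_at (c i) p.
Hypothesis sF : forall i, vsmooth_at (F i) p.

Lemma vsmooth_comb : vsmooth_at (fun q => \sum_i c i q *: F i q) p.
Proof. by apply: vsmooth_at_sum => i; exact: vsmooth_at_scale. Qed.

Lemma near_smooth_all : \forall q \near p,
  (forall i, smooth_at (c i) q) /\ forall i, vsmooth_at (F i) q.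
Proof.
apply: filterI.
  by apply: (@filter_forall _ _ (fun i q => smooth_at (c i) q) (nbhs p) _) => i;
    exact: smooth_at_near.
by apply: (@filter_forall _ _ (fun i q => vsmooth_at (F i) q) (nbhs p) _) => i;
  exact: vsmooth_at_near.
Qed.

(** Torsion freeness gives [X, Y] as the sum of c_i [F_i, Y] - (Y c_i) F_i. The terms with Y c_i
    cancel against those that the Leibniz rule produces in nabla_Y nabla_X Z. *)
Lemma curvature_combl Y Z : vsmooth_at Y p -> vsmooth_at Z p ->
  curvature D (fun q => \sum_i c i q *: F i q) Y Z p = \sum_i c i p *: curvature D (F i) Y Z p.
Proof.
move=> sY sZ; have sX := vsmooth_comb.
set X : vfield M := fun q => _.
have E : \forall q \near p, cov D X Z q = \sum_i c i q *: cov D (F i) Z q.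
  apply: filterS (vsmooth_at_near sZ) => q sZq.
  by rewrite /cov nabla_suml //; apply: eq_bigr => i _; rewrite nablaZl.
have sFZ i : vsmooth_at (cov D (F i) Z) p by exact: cov_smooth.
have L : lie_bracket X Y p =
    \sum_i (c i p *: lie_bracket (F i) Y p - (mdiff p (c i) (Y p) : R) *: F i p).
  rewrite -(tf sX sY) /cov nabla_comb // nabla_suml // -sumrB; apply: eq_bigr => i _.
  by rewrite nablaZl // -(tf (sF i) sY) scalerBr opprD addrA addrAC.
have e1 : cov D X (cov D Y Z) p = \sum_i c i p *: cov D (F i) (cov D Y Z) p.
  have sYZ := cov_smooth D sY sZ.
  by rewrite /cov nabla_suml //; apply: eq_bigr => i _; rewrite nablaZl.
have e3 : cov D (lie_bracket X Y) Z p = \sum_i (c i p *: cov D (lie_bracket (F i) Y) Z p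
    - (mdiff p (c i) (Y p) : R) *: cov D (F i) Z p).
  rewrite [LHS]/cov L nabla_suml //; apply: eq_bigr => i _.
  by rewrite nablaBl // !nablaZl.
have e2 := etrans (cov_ext erefl (cov_smooth D sX sZ) E) (nabla_comb D (Y p) (index_enum I) sc
  sFZ).
apply: etrans (congr_sub3 e1 e2 e3) _; rewrite -!sumrB; apply: eq_bigr => i _.
apply/rowP => j; rewrite !mxE /cov; ring.
Qed.

Lemma curvature_combr X Y : vsmooth_at X p -> vsmooth_at Y p ->
  curvature D X Y (fun q => \sum_i c i q *: F i q) p = \sum_i c i p *: curvature D X Y (F i) p.
Proof.
move=> sX sY; have sZ := vsmooth_comb.
set Z : vfield M := fun q => _.
have C V : vsmooth_at V p -> \forall q \near p, cov D V Z q =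
    \sum_i der V (c i) q *: F i q + \sum_i c i q *: cov D V (F i) q.
  move=> sV; apply: filterS near_smooth_all => q [scq sFq].
  by rewrite /cov nabla_comb // big_split.
have sd V i : vsmooth_at V p -> smooth_at (der V (c i)) p by move=> sV; exact: der_smooth.
have S1 V : vsmooth_at V p -> vsmooth_at (fun q => \sum_i der V (c i) q *: F i q) p.
  by move=> sV; apply: vsmooth_at_sum => i; apply: vsmooth_at_scale => //; exact: sd.
have S2 V : vsmooth_at V p -> vsmooth_at (fun q => \sum_i c i q *: cov D V (F i) q) p.
  by move=> sV; apply: vsmooth_at_sum => i; apply: vsmooth_at_scale => //; exact: cov_smooth.
have CC U V : vsmooth_at U p -> vsmooth_at V p -> cov D U (cov D V Z) p =
    \sum_i (((mdiff p (der V (c i)) (U p) : R) *: F i p + (der V (c i) p :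
      R) *: D p (U p) (F i)) +
            ((mdiff p (c i) (U p) : R) *: cov D V (F i) p + (c i p :
              R) *: D p (U p) (cov D V (F i)))).
  move=> sU sV; rewrite (cov_ext erefl (cov_smooth D sV sZ) (C V sV)).
  rewrite /cov nabla_add; [|exact: S1|exact: S2].
  rewrite nabla_comb //; last by move=> i; exact: sd.
  by rewrite nabla_comb -?big_split // => i; exact: cov_smooth.
rewrite /curvature !CC // [cov D (lie_bracket _ _) _ _]nabla_comb // -!sumrB.
apply: eq_bigr => i _; rewrite (lie_bracketE sX sY (sc i)).
exact: second_leibniz_identity.
Qed.
End Comb.

Lemma sum_delta (V : lmodType R) n (i : 'I_n) (f : 'I_n -> V) : \sum_k (k == i)%:R *: f k = f i.
Proof.
rewrite (bigD1 i) //= eqxx scale1r big1 ?addr0 // => k /negbTE ->.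
by rewrite scale0r.
Qed.

(* X is a combination of the F k near p, and agrees with F i at p. *)
Definition expands n (F : 'I_n -> vfield M) (X : vfield M) (p : M) (i : 'I_n) : Prop :=
  exists c : 'I_n -> M -> R^o, [/\ forall k, smooth_at (c k) p,
    \forall q \near p, \sum_k c k q *: F k q = X q & forall k, c k p = (k == i)%:R].

(** Linearity over functions leaves only the coefficients at p, which are Kronecker deltas.
    Linearity in the second argument comes from the first by antisymmetry. *)
Lemma curvature_expands n (F : 'I_n -> vfield M) X Y Z p i j k :
  (forall i, vsmooth_at (F i) p) -> expands F X p i -> expands F Y p j -> expands F Z p k ->
  curvature D X Y Z p = curvature D (F i) (F j) (F k) p.
Proof.
move=> sF [a [sa EX aE]] [b [sb EY bE]] [c [sc EZ cE]].
have sX := vsmooth_comb sa sF; have sY := vsmooth_comb sb sF; have sZ := vsmooth_comb sc sF.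
rewrite -(curvature_ext sX sY sZ EX EY EZ) (curvature_combl sa sF sY sZ).
under eq_bigr do rewrite aE; rewrite sum_delta.
rewrite curvature_antisym // (curvature_combl sb sF (sF i) sZ).
under eq_bigr do rewrite bE; rewrite sum_delta -curvature_antisym //.
rewrite curvature_combr //.
by under eq_bigr do rewrite cE; rewrite sum_delta.
Qed.
End CurvatureTensor.

(** * Horizontal frames *)

Lemma invsqrt_mul {R : realType} (t : R) : 0 < t -> t `^ (- 2^-1) * (t `^ (- 2^-1) * t) = 1.
Proof.
move=> t0; rewrite mulrA -powRD; last by rewrite (gt_eqF t0) implybT.
have -> : - 2^-1 + - 2^-1 = -1 :> R by field.
by rewrite powR_inv1 ?(ltW t0) // mulVf // gt_eqF.
Qed.

Section Frames.
Context {R : realType} {m n : nat} {M : manifold R m} {N : manifold R n}.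
Context {D : connection M} {g : metric M} {DN : connection N} {gN : metric N} {psi : M -> N}.
Hypothesis ssub : statistical_submersion D g DN gN psi.

Let sub : riemannian_submersion g gN psi. Proof. by case: ssub. Qed.

Local Notation covA := (covV (D := D) (g := g) (psi := psi)).

Lemma vproj_horizontal p v : horizontal g psi p v -> vproj g psi p v = 0.
Proof. by move=> hv; rewrite /vproj (hprojE sub) (hliftE sub) // subrr. Qed.

Lemma vprojD p u v : vproj g psi p (u + v) = vproj g psi p u + vproj g psi p v.
Proof.
rewrite /vproj !(hprojE sub) -addrACA -opprD; congr (_ - _).
apply: (horizontal_inj (p := p) (hlift_horizontal sub _)).
  by apply: horizontalD; exact: (hlift_horizontal sub).
by rewrite !(pushforwardD, pushforward_hlift sub).
Qed.

Lemma vprojZ p a v : vproj g psi p (a *: v) = a *: vproj g psi p v.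
Proof.
rewrite /vproj !(hprojE sub) scalerBr; congr (_ - _).
apply: (horizontal_inj (p := p) (hlift_horizontal sub _)).
  by apply: horizontalZ; exact: (hlift_horizontal sub).
by rewrite !(pushforwardZ, pushforward_hlift sub).
Qed.

Lemma vproj0 p : vproj g psi p 0 = 0.
Proof. by have := vprojZ p 0 0; rewrite !scale0r. Qed.

Lemma vproj_sum p (I : Type) (s : seq I) (v : I -> 'rV[R]_m) :
  vproj g psi p (\sum_(i <- s) v i) = \sum_(i <- s) vproj g psi p (v i).
Proof.
elim: s => [|i s IH]; first by rewrite !big_nil vproj0.
by rewrite !big_cons vprojD IH.
Qed.

(** Since U is open, the vertical part of F vanishes near r, so that the second summand of A is the
    projection of the derivative of the zero field. *)
Lemma tensorA_horizontal (U : set M) E F r : open U -> U r ->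
  horizontal_on g psi U E -> horizontal_on g psi U F ->
  tensorA D g psi E F r = vproj g psi r (cov D E F r).
Proof.
move=> oU Ur hE hF; have nU : \forall q \near r, U q by exact: open_nbhs_nbhs.
have nF : \forall q \near r, F q = hproj g psi q (F q).
  by apply: filterS nU => q /hF [_ hq]; rewrite (hprojE sub) (hliftE sub).
have nV : \forall q \near r, 0 = vproj g psi q (F q).
  by apply: filterS nU => q /hF [_ hq]; rewrite vproj_horizontal.
have hEr : hproj g psi r (E r) = E r.
  by rewrite (hprojE sub) (hliftE sub) //; have [] := hE r Ur.
have [sF _] := hF r Ur.
rewrite /tensorA -(@cov_ext _ _ _ D E _ F _ r _ sF nF) //.
rewrite -(@cov_ext _ _ _ D E _ (fun=> 0) _ r _ (vsmooth_at0 r) nV) //.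
rewrite [cov D E (fun=> 0) r]nabla0r (hprojE sub) pushforward0.
have -> : hlift g psi r 0 = 0 by rewrite -(pushforward0 psi r) (hliftE sub) //;
  exact: horizontal0.
by rewrite addr0.
Qed.

Section BasicFrame.
Variables (r : M) (b : 'I_n -> 'rV[R]_n).
Let y := psi r.
Let Bm : 'M[R]_n := \matrix_i b i.
Hypothesis uB : Bm \in unitmx.

Lemma extended_basis : exists BN : 'I_n -> vfield N,
  (forall i q, vsmooth_at (BN i) q) /\ \forall q \near y, forall i, vconst y (b i) q = BN i q.
Proof.
have [c [c1 sc]] := vconst_extension y.
exists (fun i q => c q *: vconst y (b i) q); split=> [i q|]; first exact: sc.
by apply: filterS c1 => q cq i; rewrite cq scale1r.
Qed.

Lemma horizontal_expansion (BN : 'I_n -> vfield N) (U : set M) (X : vfield M) :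
  (forall i q, vsmooth_at (BN i) q) -> (\forall q \near y, forall i, vconst y (b i) q = BN i q) ->
  open U -> U r -> horizontal_on g psi U X ->
  exists c : 'I_n -> M -> R^o, [/\ forall k, smooth_at (c k) r,
    \forall q \near r, \sum_k c k q *: hlift g psi q (BN k (psi q)) = X q &
    forall j, pushforward psi r (X r) = b j -> forall k, c k r = (k == j)%:R].
Proof.
move=> sB eB oU Ur hX; have yy := chart_dom_center y.
have sm := submersion_smooth sub.
have ny : \forall q \near r, chart_dom y (psi q) by exact: (smooth_map_near sm (chart_dom_near
  yy)).
have nb := smooth_map_near sm eB.
have nU : \forall q \near r, U q by exact: open_nbhs_nbhs.
pose w q : 'rV[R]_n := mdiff (psi q) (chart y) (pushforward psi q (X q)).
(* Coefficients of the image of X q in the fields constant in the chart y with components [b k].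
   They lift to an expansion of X because a horizontal vector is determined by its image. *)
pose c k q : R^o := (w q *m invmx Bm) 0 k.
have cE q : \sum_k c k q *: b k = w q.
  rewrite -[RHS](mulmxKV uB) [RHS]mulmx_sum_row; apply: eq_bigr => k _.
  by congr (_ *: _); apply/rowP => a; rewrite !mxE.
exists c; split.
- move=> k; have [sX _] := hX r Ur.
  apply: (@smooth_at_ext _ _ _ r (fun q =>
    \sum_a der X (chart_coord y a \o psi) q * invmx Bm a k)).
    apply: filterS ny => q yq; rewrite /c mxE; apply: eq_bigr => a _.
    by rewrite /der (mdiff_coord_comp sub).
  apply: smooth_at_sum => a; apply: smooth_at_mul; last exact: smooth_at_cst.
  by apply: der_smooth => //; exact: (pushforward_coord_smooth sub).
- apply: filterS3 ny nb nU => q yq bq Uq; have [_ hq] := hX q Uq.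
  apply: (horizontal_inj (p := q) _ hq).
    by apply: horizontal_sum => k; apply: horizontalZ; exact: (hlift_horizontal sub).
  rewrite pushforward_sum -[RHS](vconst_mdiff _ yq) -/(w q) -cE vconst_sum.
  by apply: eq_bigr => k _; rewrite pushforwardZ (pushforward_hlift sub) vconstZ bq.
- move=> j bj k; rewrite /c /w bj mdiff_chart_self.
  have -> : b j = row j Bm by apply/rowP => a; rewrite !mxE.
  by rewrite -row_mul mulmxV // !mxE eq_sym.
Qed.
End BasicFrame.

(** The Leibniz terms are multiples of the horizontal vectors [F l r] and disappear under the
    vertical projection. Hence only the values of the coefficients at r enter, in both arguments. *)
Lemma covV_comb n' (F : 'I_n' -> vfield M) (c d : 'I_n' -> M -> R^o) (E G : vfield M) r :
  (forall k, vsmooth_at (F k) r) -> (forall k q, horizontal g psi q (F k q)) ->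
  (forall k, smooth_at (d k) r) ->
  \sum_k c k r *: F k r = E r -> (\forall q \near r, \sum_k d k q *: F k q = G q) ->
  covA E G r = \sum_k \sum_l (c k r * d l r) *: covA (F k) (F l) r.
Proof.
move=> sF hF sd EE GE; have sG := vsmooth_comb sd sF.
have -> : covA E G r =
    vproj g psi r (D r (\sum_k c k r *: F k r) (fun q => \sum_k d k q *: F k q)).
  by rewrite EE; congr vproj; exact: esym (cov_ext D (erefl (E r)) sG GE).
rewrite nabla_suml // vproj_sum; apply: eq_bigr => k _.
rewrite nablaZl // vprojZ nabla_comb // vproj_sum scaler_sumr; apply: eq_bigr => l _.
rewrite vprojD !vprojZ vproj_horizontal // scaler0 add0r scalerA //.
Qed.

(** Gram-Schmidt, one field at a time. Each new field is the lift of an extended coordinate field of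
    N, and the domain shrinks to the points where the orthogonalised field C does not vanish. *)
Lemma horizontal_frame_exists r : exists (U : set M) (X : 'I_n -> vfield M),
  horizontal_frame g psi U X /\ U r.
Proof.
have [c [c1 sc]] := vconst_extension (psi r).
(* Indexing the fields by natural numbers lets a partial frame grow without a change of type; only
   the indices below k matter. *)
have H k : (k <= n)%N -> exists (U : set M) (X : nat -> vfield M), [/\ open U, U r,
    forall i, (i < k)%N -> horizontal_on g psi U (X i) &
    forall i j p, (i < k)%N -> (j < k)%N -> U p -> g p (X i p) (X j p) = (i == j)%:R].
  elim: k => [|k IH] kn; first by exists setT, (fun _ _ => 0); split=> //; exact: openT.
  have [U [X [oU Ur hX gX]]] := IH (ltnW kn).
  (* The rows are the images at r of the fields found so far. Being fewer than n, they miss some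
     coordinate vector; if C vanished at r, that vector would lie in their span. *)
  pose K : 'M[R]_(k, n) := \matrix_(i < k) pushforward psi r (X i r).
  have [a aK] : exists a : 'I_n, ~~ ((delta_mx 0 a : 'rV[R]_n) <= K)%MS.
    apply: contrapT => nex.
    have aK a : ((delta_mx 0 a : 'rV[R]_n) <= K)%MS.
      by apply: contrapT => /negP h; apply: nex; exists a.
    have : (1%:M <= K)%MS.
      by apply/row_subP => i; rewrite row1; exact: aK.
    move=> /mxrankS; rewrite mxrank1 leqNgt => /negP; apply.
    exact: leq_ltn_trans (rank_leq_row _) kn.
  pose WN : vfield N := fun q => c q *: vconst (psi r) (delta_mx 0 a) q.
  pose W : vfield M := fun q => hlift g psi q (WN (psi q)).
  have bW : basic g psi W WN by apply: (hlift_basic ssub) => q; exact: sc.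
  pose C : vfield M := fun q => W q - \sum_(i < k) (g q (W q) (X i q) : R^o) *: X i q.
  have hC q : U q -> vsmooth_at C q /\ horizontal g psi q (C q).
    move=> Uq; split.
      apply: vsmooth_at_sub; first exact: (basic_smooth bW).
      apply: vsmooth_at_sum => i; have [sX _] := hX i (ltn_ord i) q Uq.
      apply: vsmooth_at_scale => //; apply: metric_smooth => //; exact: (basic_smooth bW).
    apply: horizontalB; first exact: (basic_horizontal bW).
    apply: horizontal_sum => i; apply: horizontalZ; by have [] := hX i (ltn_ord i) q Uq.
  have gC q j : U q -> (j < k)%N -> g q (C q) (X j q) = 0.
    move=> Uq jk; rewrite /C metricBl metric_suml (bigD1 (Ordinal jk)) //= big1.
      by rewrite addr0 metricZl (gX j j) // eqxx mulr1 subrr.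
    move=> i ij; rewrite metricZl (gX i j) //.
    by rewrite (negbTE (_ : (i : nat) != j)) ?mulr0.
  have C0 : C r != 0.
    apply/negP => /eqP /eqP; rewrite subr_eq0 => /eqP WE; move/negP: aK; apply.
    have -> : delta_mx 0 a = pushforward psi r (W r).
      rewrite (basic_pushforward bW) /WN (nbhs_singleton c1) scale1r.
      by rewrite -[RHS](mdiff_chart_self (psi r)) mdiff_vconst //; exact: chart_dom_center.
    rewrite WE pushforward_sum; apply: summx_sub => i _.
    rewrite pushforwardZ; apply: scalemx_sub.
    have -> : pushforward psi r (X i r) = row i K by apply/rowP => j; rewrite !mxE.
    exact: row_sub.
  pose f : M -> R^o := fun q => g q (C q) (C q).
  have sf q : U q -> smooth_at f q.
    by move=> Uq; apply: metric_smooth; have [] := hC q Uq.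
  have f0 : \forall q \near r, 0 < f q.
    have cf := smooth_at_continuous (sf r Ur).
    by apply: (cvgr_gt (f r) cf); exact: metric_pos.
  pose U' := U `&` interior [set q | 0 < f q].
  exists U', (fun i => if i == k then (fun q => (f q `^ (- 2^-1)) *: C q) else X i); split.
  - by apply: openI => //; exact: open_interior.
  - by split.
  - move=> i; rewrite ltnS leq_eqVlt => /orP[/eqP -> |ik] p [Up /interior_subset fp].
      have [sC hCp] := hC p Up; rewrite eqxx; split; last exact: horizontalZ.
      by apply: vsmooth_at_scale => //; apply: smooth_at_powR => //; exact: sf.
    by rewrite (ltn_eqF ik); exact: hX.
  - move=> i j p; rewrite !ltnS [(i <= k)%N]leq_eqVlt [(j <= k)%N]leq_eqVlt.
    move=> /orP[/eqP -> |ik] /orP[/eqP -> |jk] [Up /interior_subset fp].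
    + by rewrite !eqxx metricZl metricZr invsqrt_mul.
    + by rewrite eqxx (ltn_eqF jk) metricZl gC // mulr0 gtn_eqF.
    + by rewrite eqxx (ltn_eqF ik) metricZr metric_sym gC // mulr0.
    + by rewrite (ltn_eqF ik) (ltn_eqF jk) gX.
have [U [X [oU Ur hX gX]]] := H n (leqnn n).
exists U, (fun i => X i); split=> //; split=> // [i p Up|p Up i j]; first exact: hX.
by rewrite gX.
Qed.
End Frames.

(** * The scalar curvatures *)

(** For the pair (i, j), x is the curvature term of N, y = g(A_jj, A_ii), z = g(A_ij, A_ij) and t =
    g(A_ji, A_ij). *)
Lemma defect_summand (R : comRingType) (x y z t : R) :
  x + y - z - (z - t) = x + y - (2 * z - t).
Proof. by ring. Qed.

Section Defect.
Context {R : realType} {m n : nat} {M : manifold R m} (g : metric M) (r : M).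
Variable A : 'I_n -> 'I_n -> 'rV[R]_m.

(** Applied to A_ij = A_(X_i) X_j, this is the gap between the two sides of the inequality. *)
Definition defect : R := \sum_i \sum_j (2 * g r (A i j) (A i j) - g r (A j i) (A i j)).

Lemma defect_ge : \sum_i \sum_j g r (A i j) (A i j) <= defect.
Proof.
have -> : defect = \sum_i \sum_j g r (A i j) (A i j) +
    2^-1 * \sum_i \sum_j g r (A i j - A j i) (A i j - A j i).
  pose q i j := g r (A i j) (A i j).
  have E : \sum_i \sum_j g r (A i j - A j i) (A i j - A j i) =
      \sum_i \sum_j (2 * (q i j - g r (A j i) (A i j))).
    (* One of the two copies of the sum of [q i j] is written with i and j exchanged, to match the
       expansion of the square. *)
    have -> : \sum_i \sum_j (2 * (q i j - g r (A j i) (A i j))) =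
      \sum_i \sum_j (q i j - 2 * g r (A j i) (A i j)) + \sum_i \sum_j q j i.
      rewrite [X in _ + X]exchange_big -big_split /=; apply: eq_bigr => i _.
      rewrite -big_split /=; apply: eq_bigr => j _.
      by ring.
    rewrite -big_split /=; apply: eq_bigr => i _; rewrite -big_split /=; apply: eq_bigr => j _.
    rewrite metricBl !metricBr (metric_sym g r (A i j) (A j i)) /q.
    by ring.
  rewrite E mulr_sumr -big_split /=; apply: eq_bigr => i _.
  rewrite mulr_sumr -big_split /=; apply: eq_bigr => j _.
  by rewrite /q; move: (g r (A i j) (A i j)) (g r (A j i) (A i j)) => x y; field.
rewrite lerDl mulr_ge0 ?invr_ge0 // sumr_ge0 // => i _; apply: sumr_ge0 => j _.
exact: metric_ge0.
Qed.

Lemma sum_metric_ge0 : 0 <= \sum_i \sum_j g r (A i j) (A i j).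
Proof. by apply: sumr_ge0 => i _; apply: sumr_ge0 => j _; exact: metric_ge0. Qed.

Lemma defect_eq0 : defect = 0 <-> forall i j, A i j = 0.
Proof.
split=> [d0 i j|A0]; last first.
  by rewrite /defect big1 // => i _; rewrite big1 // => j _; rewrite !A0 metric0l mulr0 subr0.
have q0 k l : 0 <= g r (A k l) (A k l) by exact: metric_ge0.
have s0 : \sum_i \sum_j g r (A i j) (A i j) = 0.
  by apply/eqP; rewrite eq_le sum_metric_ge0 andbT; have := defect_ge; rewrite d0.
apply/(@metric_eq0 _ _ _ g r)/eqP; rewrite eq_le q0 andbT -s0.
rewrite (bigD1 i) //= (bigD1 j) //= -addrA lerDl addr_ge0 //; first exact: sumr_ge0.
by apply: sumr_ge0 => k _; exact: sumr_ge0.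
Qed.
End Defect.

Section ScalarCurvature.
Context {R : realType} {m n : nat} {M : manifold R m} {N : manifold R n}.
Context {D : connection M} {g : metric M} {DN : connection N} {gN : metric N} {psi : M -> N}.
Hypothesis statM : statistical D g.
Hypothesis statN : statistical DN gN.
Hypothesis ssub : statistical_submersion D g DN gN psi.

Let sub : riemannian_submersion g gN psi. Proof. by case: ssub. Qed.

Local Notation covA := (covV (D := D) (g := g) (psi := psi)).

Section AtPoint.
Variables (U : set M) (X : 'I_n -> vfield M) (r : M).
Hypotheses (frX : horizontal_frame g psi U X) (Ur : U r).

Let b i := pushforward psi r (X i r).

(** The images of the frame vectors are orthonormal for gN because psi is isometric on horizontal
    vectors, hence independent. *)
Lemma pushforward_frame_unit : (\matrix_i b i : 'M[R]_n) \in unitmx.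
Proof.
have [oU hX gX] := frX; apply: unitmx_inj => c; rewrite mulmx_sum_row => c0.
apply/rowP => j; rewrite mxE -[LHS]mulr1.
have bb i : gN (psi r) (b i) (b j) = (i == j)%:R.
  rewrite (metric_pushforward sub) ?gX //; first by have [] := hX i r Ur.
  by have [] := hX j r Ur.
have : gN (psi r) (\sum_i c 0 i *: row i (\matrix_i b i)) (b j) = 0 by rewrite c0 metric0l.
rewrite metric_suml (bigD1 j) //= big1 => [|i ij].
  by rewrite rowK metricZl bb eqxx addr0.
by rewrite rowK metricZl bb (negbTE ij) mulr0.
Qed.

(** The X i are orthonormal but need not be basic; the F i are basic but need not be orthonormal
    away from r. Every term of the inequality is tensorial, so agreement at r suffices. The last
    clause, on arbitrary horizontal fields near r, makes A vanish on all of them once the A_ij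
    vanish. *)
Lemma frame_comparison : exists (F : 'I_n -> vfield M) (BN : 'I_n -> vfield N),
  [/\ forall i, basic g psi (F i) (BN i),
      forall i, BN i (psi r) = b i,
      forall i j k, curvature D (X i) (X j) (X k) r = curvature D (F i) (F j) (F k) r,
      forall i j k, hat_curvature g DN psi (X i) (X j) (X k) r =
        hlift g psi r (curvature DN (BN i) (BN j) (BN k) (psi r)) &
      (forall i j, tensorA D g psi (X i) (X j) r = covA (F i) (F j) r) /\
      forall (W : set M) (Y Z : vfield M), open W -> W r ->
        horizontal_on g psi W Y -> horizontal_on g psi W Z ->
        exists c d : 'I_n -> R, tensorA D g psi Y Z r =
          \sum_k \sum_l (c k * d l) *: covA (F k) (F l) r].
Proof.
have [oU hX gX] := frX; have yy := chart_dom_center (psi r).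
have [BN [sB eB]] := extended_basis (psi := psi) r b.
pose F k : vfield M := fun q => hlift g psi q (BN k (psi q)).
have bF k : basic g psi (F k) (BN k) by exact: (hlift_basic ssub (sB k)).
have sF k : vsmooth_at (F k) r by exact: (basic_smooth (bF k)).
have hF k q : horizontal g psi q (F k q) by exact: (hlift_horizontal sub).
have ex := horizontal_expansion ssub pushforward_frame_unit sB eB.
have exX i : expands F (X i) r i.
  by have [c [sc cE cd]] := ex _ _ oU Ur (hX i); exists c; split=> //; exact: cd.
exists F, BN; split=> // [i|i j k|i j k|].
- rewrite -(nbhs_singleton eB) -[LHS](mdiff_chart_self (psi r)).
  exact: mdiff_vconst.
- exact: (curvature_expands statM.1).
(* [curvature_at] extends vectors by fields constant in the chart at psi r, and the BN agree with
   those near psi r. *)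
- rewrite /hat_curvature /curvature_at; congr hlift.
  apply: (curvature_ext statN.1); try exact: vconst_smooth.
  + by apply: filterS eB => q ->.
  + by apply: filterS eB => q ->.
  + by apply: filterS eB => q ->.
split=> [i j|W Y Z oW Wr hY hZ].
  rewrite (tensorA_horizontal ssub oU Ur (hX i) (hX j)).
  have [c [sc cE cd]] := exX i; have [d [sd dE dd]] := exX j.
  rewrite -/(covA (X i) (X j) r) (covV_comb ssub sF hF sd (nbhs_singleton cE) dE).
  rewrite -[RHS](sum_delta i (fun k => covA (F k) (F j) r)); apply: eq_bigr => k _.
  rewrite -(sum_delta j (fun l => covA (F k) (F l) r)) scaler_sumr; apply: eq_bigr => l _.
  by rewrite cd dd scalerA.
rewrite (tensorA_horizontal ssub oW Wr hY hZ).
have [c [sc cE _]] := ex _ _ oW Wr hY; have [d [sd dE _]] := ex _ _ oW Wr hZ.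
exists (fun k => c k r), (fun k => d k r).
by rewrite -/(covA Y Z r) (covV_comb ssub sF hF sd (nbhs_singleton cE) dE).
Qed.

Lemma twoR_defect : let s := sigma_field D g psi X r in
  twoR D g X r = twoRhat g DN psi X r + g r s s
    - defect g r (fun i j => tensorA D g psi (X i) (X j) r).
Proof.
move=> s; have [F [BN [bF Bb cX hc [AE _]]]] := frame_comparison.
have [A {}AE AF] : exists2 A : 'I_n -> 'I_n -> 'rV[R]_m,
    (fun i j => tensorA D g psi (X i) (X j) r) = A & forall i j, covA (F i) (F j) r = A i j.
  by exists (fun i j => covA (F i) (F j) r) => //; apply/funext => i; apply/funext => j.
have FX i : F i r = X i r.
  have [_ hX _] := frX; have [_ hXi] := hX i r Ur.
  apply: (horizontal_inj (p := r) (basic_horizontal (bF i) (p := r)) hXi).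
  by rewrite (basic_pushforward (bF i)) Bb.
have -> : g r s s = \sum_i \sum_j g r (A j j) (A i i).
  have -> : s = \sum_i A i i by rewrite -AE.
  by rewrite metric_sumr; apply: eq_bigr => i _; rewrite metric_suml.
rewrite AE /twoR /twoRhat /defect -big_split -sumrB /=; apply: eq_bigr => i _.
rewrite -big_split -sumrB /=; apply: eq_bigr => j _.
rewrite cX -FX (curvature_basic statM statN ssub (bF i) (bF j) (bF j) (bF i)) hc.
rewrite !AF metricBl.
rewrite -(basic_pushforward (bF i)) -[X in gN _ X _](pushforward_hlift sub r).
rewrite -(metric_horizontal ssub _ (basic_horizontal (bF i) (p := r))).
by rewrite defect_summand.
Qed.
End AtPoint.
End ScalarCurvature.

(** * The inequality and its equality case *)

Theorem theorem4p4 (R : realType) (m n : nat) (M : manifold R m)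
    (N : manifold R n) (D : connection M) (g : metric M)
    (DN : connection N) (gN : metric N) (psi : M -> N)
    (statM : statistical D g) (statN : statistical DN gN)
    (sub : statistical_submersion D g DN gN psi) :
  (forall (U : set M) (X : 'I_n -> vfield M), horizontal_frame g psi U X ->
     forall r : M, U r ->
       let s := sigma_field D g psi X r in
       twoR D g X r <= twoRhat g DN psi X r + g r s s /\
       (twoR D g X r = twoRhat g DN psi X r + g r s s <->
        forall (W : set M) (Y Z : vfield M), open W -> W r ->
          horizontal_on g psi W Y -> horizontal_on g psi W Z ->
          tensorA D g psi Y Z r = 0)) /\
  ((forall (U : set M) (X : 'I_n -> vfield M), horizontal_frame g psi U X ->
      forall r : M, U r ->
        let s := sigma_field D g psi X r in
        twoR D g X r = twoRhat g DN psi X r + g r s s) <->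
   (forall Y Z : vfield M,
      horizontal_on g psi setT Y -> horizontal_on g psi setT Z ->
      forall r : M, tensorA D g psi Y Z r = 0)).
Proof.
have eqP0 (U : set M) (X : 'I_n -> vfield M) r : horizontal_frame g psi U X -> U r ->
    let s := sigma_field D g psi X r in
    twoR D g X r = twoRhat g DN psi X r + g r s s <->
    forall i j, tensorA D g psi (X i) (X j) r = 0.
  move=> frX Ur s; rewrite -(defect_eq0 g r (fun i j => tensorA D g psi (X i) (X j) r)).
  rewrite (twoR_defect statM statN sub frX Ur) -/s; split=> [/eqP|->]; last by rewrite subr0.
  by rewrite -subr_eq0 addrAC subrr sub0r oppr_eq0 => /eqP.
have local (U : set M) (X : 'I_n -> vfield M) r : horizontal_frame g psi U X -> U r ->
    let s := sigma_field D g psi X r in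
    twoR D g X r = twoRhat g DN psi X r + g r s s <->
    forall (W : set M) (Y Z : vfield M), open W -> W r ->
      horizontal_on g psi W Y -> horizontal_on g psi W Z -> tensorA D g psi Y Z r = 0.
  move=> frX Ur s; rewrite (eqP0 U X r frX Ur); split=> [A0 W Y Z oW Wr hY hZ|A0 i j].
    have [F [BN [_ _ _ _ [AE]]]] := frame_comparison statM statN sub frX Ur.
    move=> /(_ W Y Z oW Wr hY hZ) [c [d ->]].
    by rewrite big1 // => k _; rewrite big1 // => l _; rewrite -AE A0 scaler0.
  by have [oU hX _] := frX; exact: (A0 U).
split=> [U X frX r Ur s|].
  split; last exact: (local U X r frX Ur).
  rewrite (twoR_defect statM statN sub frX Ur) gerDl oppr_le0.
  exact: le_trans (sum_metric_ge0 _ _ _) (defect_ge _ _ _).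
split=> [eqR Y Z hY hZ r|A0 U X frX r Ur s].
  (* The assumed equality yields information at r only through some frame around r. *)
  have [U [X [frX Ur]]] := horizontal_frame_exists sub r.
  by apply: ((local U X r frX Ur).1 (eqR U X frX r Ur) setT) => //; exact: openT.
apply: (eqP0 U X r frX Ur).2 => i j.
(* The comparison fields are horizontal on all of M, so the hypothesis on global fields reaches each
   A_ij at r, although the frame itself is only local. *)
have [F [BN [bF _ _ _ [AE _]]]] := frame_comparison statM statN sub frX Ur.
have hF k : horizontal_on g psi setT (F k) by have [] := bF k.
by rewrite AE -(A0 _ _ (hF i) (hF j) r) (tensorA_horizontal sub openT I (hF i) (hF j)).
Qed.
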